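(* Let $A,B\in\mathbb{R}^{n\times n}$ and assume that the linear delay-differential equation $\dot x(t)=Ax(t)+Bx(t-\tau)$ is of universality class I, with corresponding frequency $\omega_H>0$ and branch index $j$. Then the system has a sequence of destabilizing delay-induced crossings of the critical characteristic roots with $\lambda_c=\pm i\omega_H$ for the time delays $$\tau=\tau_k=\frac1{\omega_H}(\phi_H+2\pi k),\quad k=0,1,2,\dots,$$ where $\phi_H=-\arg[Y_j(\omega_H)]$. Moreover, there are no other transverse delay-induced crossings of the characteristic roots in this system.
   Context: The DDE is $\dot x(t)=Ax(t)+Bx(t-\tau)$ with real $n\times n$ matrices $A,B$ and time delay $\tau>0$ regarded as a parameter. Its characteristic equation is $\det[\lambda I-A-Be^{-\lambda\tau}]=0$; solutions $\lambda$ are called characteristic roots. Delay-induced transverse crossing at $\tau=\tau_H$: there is a family of roots $\lambda(\tau)=\alpha(\tau)\pm i\mu(\tau)$ of the characteristic equation with $\alpha(\tau_H)=0$ and $\frac{d\alpha}{d\tau}(\tau_H)\neq0$. It is called stabilizing if $\frac{d\alpha}{d\tau}(\tau_H)<0$ and destabilizing if $\frac{d\alpha}{d\tau}(\tau_H)>0$. Generating polynomial: $p_\omega(Y)=\det[i\omega I-A-BY]$. Asymptotic continuous spectrum (ACS): the collection of curves $\left\{\frac1\tau\gamma_j(\omega)+i\omega\right\}$, $\omega\in\mathbb{R}$, $j=1,\dots,m$, where $\gamma_j(\omega)=-\ln|Y_j(\omega)|$ and $Y_j(\omega)$ are the roots of the generating polynomial, $p_\omega(Y_j(\omega))=0$.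 Points $\omega$ for which the polynomial is degenerate, i.e. $p_\omega(Y)\equiv\det[i\omega I-A]$ for all $Y$, are excluded. A branch of the ACS is one of the functions $\gamma_j$. Universality class I: the ACS (and the DDE) is of universality class I if there exist $\omega_H>0$ and $j\in\mathbb{N}$ such that one branch of the ACS satisfies $\gamma_j(\pm\omega_H)=0$, $\gamma_j(\omega)>0$ for all $\omega\in(-\omega_H,\omega_H)$, and $\gamma_j(\omega)<0$ for all $\omega\notin[-\omega_H,\omega_H]$; also $\gamma_k(\omega)\neq0$ for all $k\neq j$ and $\omega\in\mathbb{R}$. $\arg$ denotes the principal argument in $(-\pi,\pi]$.
   Formalization: The destabilizing crossings are asserted only when γ_j'(ω_H) ≠ 0; if γ_j'(ω_H) = 0 then dα/dτ = 0 at all but at most one τ_k and the claim fails. At excluded ω, the branches γ_k take their continuous extension, to which the class I conditions also apply. *)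

(* Defs.v *)
From HB Require Import structures.
From mathcomp Require Import all_boot all_order all_algebra.
From mathcomp Require Import all_classical all_reals all_analysis.
From mathcomp Require Import complex.

Set Implicit Arguments.
Unset Strict Implicit.
Unset Printing Implicit Defensive.

Import Order.TTheory GRing.Theory Num.Theory.
Import numFieldNormedType.Exports.

Local Open Scope ring_scope.
Local Open Scope complex_scope.

Section ComplexFunctions.
Variable R : realType.
Implicit Type z : R[i].

Definition cexp z : R[i] :=
  (expR (complex.Re z) * cos (complex.Im z))
    +i* (expR (complex.Re z) * sin (complex.Im z)).

Definition cabs z : R := complex.Re `|z|.

(* For z <> 0 this is the principal argument, in the interval (-pi, pi]. *)
Definition carg z : R :=
  if 0 <= complex.Im z then acos (complex.Re z / cabs z)
  else - acos (complex.Re z / cabs z).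

End ComplexFunctions.

Section DelayEquation.
Variables (R : realType) (n : nat).
Implicit Types (A B : 'M[R]_n) (lambda : R[i]) (tau omega : R).

Definition char_fun A B tau lambda : R[i] :=
  \det (lambda%:M - map_mx (real_complex R) A
        - cexp (- (lambda * tau%:C)) *: map_mx (real_complex R) B).

Definition char_root A B tau lambda : Prop := char_fun A B tau lambda = 0.

(* At the delay tauH the pair of characteristic roots alpha(tau) +/- i mu(tau)
   reaches the imaginary axis at +/- i omega, with alpha'(tauH) = d.  The
   characteristic equation makes sense for every real tau; positivity of the
   delay is not part of this definition. *)
Definition axis_contact A B (tauH omega d : R) : Prop :=
  exists alpha mu : R -> R,
    [/\ (\forall tau \near tauH,
           [/\ char_root A B tau (alpha tau +i* mu tau),
               char_root A B tau (alpha tau -i* mu tau),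
               {for tau, continuous alpha} & {for tau, continuous mu}]),
        alpha tauH = 0,
        mu tauH = omega &
        is_derive tauH 1 alpha d].

Definition transverse_crossing A B (tauH omega : R) : Prop :=
  exists2 d, d != 0 & axis_contact A B tauH omega d.

Definition destabilizing_crossing A B (tauH omega : R) : Prop :=
  exists2 d, 0 < d & axis_contact A B tauH omega d.

(* The polynomial det [i omega I - A - B Y] in the variable Y. *)
Definition genpoly A B omega : {poly R[i]} :=
  \det (map_mx polyC ((0 +i* omega)%:M - map_mx (real_complex R) A)
        - 'X *: map_mx polyC (map_mx (real_complex R) B)).

Definition degenerate A B omega : Prop :=
  genpoly A B omega
    = (\det ((0 +i* omega)%:M - map_mx (real_complex R) A))%:P.

(* A branch takes its values in C extended by a point at infinity, None: where
   the degree in Y of the generating polynomial drops, some of the roots escape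
   to infinity. *)
Definition emodulus (y : option R[i]) : \bar R :=
  (if y is Some z then (cabs z)%:E else +oo)%E.

(* - ln |Y|, with value +oo at Y = 0 and -oo at Y = infinity. *)
Definition acs_gamma (y : option R[i]) : \bar R := (- lne (emodulus y))%E.

(* Y_0, ..., Y_(m-1) list the roots, with multiplicity, of the generating
   polynomial at every omega where it is not degenerate, m being its generic
   degree in Y, and the gamma_k = - ln |Y_k| are curves.  At a degenerate omega
   the equation in Y imposes nothing on the branches: the value of gamma_k is
   then the one given by continuity. *)
Definition acs_branches A B (m : nat) (Y : 'I_m -> R -> option R[i]) : Prop :=
  [/\ (exists omega, size (genpoly A B omega) = m.+1),
      (forall omega, ~ degenerate A B omega ->
         genpoly A B omega
         = lead_coef (genpoly A B omega) *:
             \prod_(k < m) (if Y k omega is Some y then 'X - y%:P else 1)) &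
      (forall k, continuous (fun omega => acs_gamma (Y k omega)))].

Definition universality_class_I A B (m : nat) (Y : 'I_m -> R -> option R[i])
    (j : 'I_m) (omegaH : R) : Prop :=
  [/\ 0 < omegaH,
      [/\ ~ degenerate A B omegaH, ~ degenerate A B (- omegaH),
          acs_gamma (Y j omegaH) = 0%E & acs_gamma (Y j (- omegaH)) = 0%E],
      (forall omega, - omegaH < omega < omegaH ->
         (0 < acs_gamma (Y j omega))%E),
      (forall omega, ~~ (- omegaH <= omega <= omegaH) ->
         (acs_gamma (Y j omega) < 0)%E) &
      (forall k omega, k != j -> acs_gamma (Y k omega) <> 0%E)].

(* The curve gamma crosses zero at omegaH with nonzero slope. *)
Definition transverse_branch (Yj : R -> option R[i]) (omegaH : R) : Prop :=
  derive1 (fun omega => fine (acs_gamma (Yj omega))) omegaH != 0.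

(* phi_H = - arg Y_j(omegaH); the value at infinity is never used. *)
Definition crossing_phase (Yj : R -> option R[i]) (omegaH : R) : R :=
  if Yj omegaH is Some y then - carg y else 0.

Definition crossing_delay (Yj : R -> option R[i]) (omegaH : R) (k : nat) : R :=
  omegaH^-1 * (crossing_phase Yj omegaH + 2 * pi * k%:R).

End DelayEquation.

(* Main.v *)
(* Let P(l, Y) = det(l - A - Y B), so that the characteristic equation reads
   P(l, exp(- l tau)) = 0.

   At a crossing, exp(- i omega tau) is a unimodular root of P(i omega, .), so
   some gamma_k vanishes at omega.  If P(i omega, .) vanishes identically, the
   factor (l - i omega)^r has to be divided out first: since alpha' <> 0 the
   root leaves i omega, hence it is a root of the quotient, and the gamma_k, being
   continuous, still describe the moduli of the roots of the quotient at i omega.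
   Class I then forces omega = +/- omegaH, and exp(- i omegaH tau) = Y_j(omegaH)
   determines tau modulo 2 pi / omegaH.

   Conversely Y_j(omegaH) is a simple root.  With q = P_l / (Y P_Y) at
   (i omegaH, Y_j(omegaH)), implicit differentiation of P(i omega, Y_j(omega)) = 0
   gives gamma_j'(omegaH) = - Im q, and that of P(l, exp(- l tau)) = 0 gives
   l'(tau) = i omegaH / (q - tau), whose real part is
   omegaH Im q / |q - tau|^2.  The latter is positive since gamma_j decreases
   through 0 at omegaH. *)
From HB Require Import structures.
Require Import Defs.
From mathcomp Require Import all_boot all_order all_algebra.
From mathcomp Require Import all_classical all_reals all_analysis.
From mathcomp Require Import complex.
From mathcomp Require Import ring lra.

Set Implicit Arguments.
Unset Strict Implicit.
Unset Printing Implicit Defensive.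

Import Order.TTheory GRing.Theory Num.Theory.
Import numFieldNormedType.Exports.

Local Open Scope ring_scope.

(* The join of the pointed and filtered structures is not declared for products
   in the library. *)
HB.saturate prod.

(** * The complex modulus with real values *)

Section ModulusTheory.
Local Open Scope complex_scope.

Lemma cabsE (R : realType) (z : R[i]) : `|z| = (cabs z)%:C.
Proof. by rewrite /cabs normc_def. Qed.

Lemma cabs_ge0 (R : realType) (z : R[i]) : 0 <= cabs z.
Proof. by rewrite -(@lecR R) -cabsE normr_ge0. Qed.

Lemma cabsM (R : realType) (x y : R[i]) : cabs (x * y) = cabs x * cabs y.
Proof. by apply: complexI; rewrite rmorphM /= -!cabsE normrM. Qed.

Lemma cabsD (R : realType) (x y : R[i]) : cabs (x + y) <= cabs x + cabs y.
Proof. by rewrite -(@lecR R) rmorphD /= -!cabsE ler_normD. Qed.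

Lemma cabsN (R : realType) (x : R[i]) : cabs (- x) = cabs x.
Proof. by rewrite /cabs normrN. Qed.

Lemma cabsB (R : realType) (x y : R[i]) : cabs (x - y) = cabs (y - x).
Proof. by rewrite -cabsN opprB. Qed.

Lemma cabs_eq0 (R : realType) (x : R[i]) : (cabs x == 0) = (x == 0).
Proof. by rewrite -(inj_eq (@complexI R)) -cabsE normr_eq0. Qed.

Lemma cabs0 (R : realType) : cabs (0 : R[i]) = 0.
Proof. by apply/eqP; rewrite cabs_eq0. Qed.

Lemma cabs1 (R : realType) : cabs (1 : R[i]) = 1.
Proof. by rewrite /cabs normr1. Qed.

Lemma cabs_gt0 (R : realType) (x : R[i]) : (0 < cabs x) = (x != 0).
Proof. by rewrite lt_neqAle cabs_ge0 andbT eq_sym cabs_eq0. Qed.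

Lemma cabs_sqr (R : realType) (z : R[i]) :
  cabs z ^+ 2 = complex.Re z ^+ 2 + complex.Im z ^+ 2.
Proof. by apply: complexI; rewrite rmorphXn /= -cabsE -add_Re2_Im2. Qed.

Lemma cabs_real (R : realType) (x : R) : cabs x%:C = `|x|.
Proof.
apply/eqP; rewrite -(@eqrXn2 _ 2) ?cabs_ge0 // cabs_sqr /=.
by rewrite expr0n addr0 real_normK ?num_real.
Qed.

Lemma Re_le_cabs (R : realType) (z : R[i]) : `|complex.Re z| <= cabs z.
Proof. by rewrite -(@lecR R) -cabsE normc_ge_Re. Qed.

Lemma Im_le_cabs (R : realType) (z : R[i]) : `|complex.Im z| <= cabs z.
Proof.
rewrite -(@ler_pXn2r _ 2) ?nnegrE ?cabs_ge0 // cabs_sqr real_normK ?num_real //.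
by rewrite lerDr sqr_ge0.
Qed.

Lemma cabs_le_ReIm (R : realType) (z : R[i]) :
  cabs z <= `|complex.Re z| + `|complex.Im z|.
Proof.
rewrite -(@ler_pXn2r _ 2) ?nnegrE ?cabs_ge0 ?addr_ge0 // cabs_sqr sqrrD.
rewrite !real_normK ?num_real // addrAC lerDl mulrn_wge0 // mulr_ge0 //.
Qed.

Lemma cabs_prod (R : realType) (I : Type) (r : seq I) (F : I -> R[i]) :
  cabs (\prod_(i <- r) F i) = \prod_(i <- r) cabs (F i).
Proof. exact: (big_morph _ (@cabsM R) (@cabs1 R)). Qed.

End ModulusTheory.

(** * Completeness of a product of Banach spaces *)

Section ProdComplete.
Local Open Scope classical_set_scope.
Variables (R : realType) (U V : completeNormedModType R).

(** Both projections of a Cauchy filter are Cauchy, and the pair of their limits is a limit. This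
    makes the Banach fixed point theorem available on [R * R]. *)
Lemma prod_complete (F : set_system (U * V)) :
  ProperFilter F -> cauchy F -> cvg F.
Proof.
move=> FF /cauchy_ballP Fc.
have c1 : cvg (fst @ F).
  apply/cauchy_cvgP; apply/cauchy_ballP => e e0.
  case: (Fc e e0) => -[A B] /= [FA FB] AB.
  exists (fst @` A, fst @` B) => /=.
    by split; [apply: filterS FA | apply: filterS FB] => x Ax; exists x.
  by move=> [x y] /= [[a Aa <-] [b Bb <-]]; case: (AB (a, b) (conj Aa Bb)).
have c2 : cvg (snd @ F).
  apply/cauchy_cvgP; apply/cauchy_ballP => e e0.
  case: (Fc e e0) => -[A B] /= [FA FB] AB.
  exists (snd @` A, snd @` B) => /=.
    by split; [apply: filterS FA | apply: filterS FB] => x Ax; exists x.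
  by move=> [x y] /= [[a Aa <-] [b Bb <-]]; case: (AB (a, b) (conj Aa Bb)).
apply/cvg_ex; exists (lim (fst @ F), lim (snd @ F)).
move=> A [[B C] /= [nB nC] BC].
have FB : F (fst @^-1` B) := c1 _ nB.
have FC : F (snd @^-1` C) := c2 _ nC.
apply: (@filterS _ F _ _ _ _ (filterI FB FC)) => -[x y] [Bx Cy].
exact: (BC (x, y)).
Qed.

HB.instance Definition _ := Uniform_isComplete.Build (U * V)%type prod_complete.
End ProdComplete.

(** * Strict differentiability of functions of a complex and a real variable *)

Section StrictDiff.
Local Open Scope complex_scope.
Local Open Scope classical_set_scope.
Variable R : realType.
Implicit Types (f g : R * R * R -> R[i]) (p q : R * R * R) (u : R * R).

Definition cpt u : R[i] := u.1 +i* u.2.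

Lemma cpt0 : cpt 0 = 0. Proof. by []. Qed.

Lemma cptB u v : cpt (u - v) = cpt u - cpt v.
Proof. by case: u v => [a b] [c d]. Qed.

Lemma cabs_cpt_le u : cabs (cpt u) <= 2 * `|u|.
Proof.
apply: (le_trans (cabs_le_ReIm _)) => /=.
by rewrite mulrDl !mul1r lerD // prod_normE le_max lexx ?orbT.
Qed.

Lemma cabs_cpt_ge u : `|u| <= cabs (cpt u).
Proof. by rewrite prod_normE ge_max (Re_le_cabs (cpt u)) (Im_le_cabs (cpt u)). Qed.

(** Both points move near [p0]: this two-point form yields contraction and Lipschitz estimates
    directly. The differential is complex linear in the first variable, with partial derivatives [a]
    and [b]. *)
Definition strictly_diff f p0 (a b : R[i]) := forall e : R, 0 < e ->
  \forall pq \near filter_prod (nbhs p0) (nbhs p0),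
    cabs (f pq.1 - f pq.2
          - (a * cpt (pq.1.1 - pq.2.1) + b * (pq.1.2 - pq.2.2)%:C))
    <= e * `|pq.1 - pq.2|.

Lemma cabs_linear_le (a b : R[i]) p :
  cabs (a * cpt p.1 + b * p.2%:C) <= (2 * cabs a + cabs b) * `|p|.
Proof.
apply: (le_trans (cabsD _ _)); rewrite !cabsM cabs_real mulrDl.
apply: lerD; last by rewrite ler_wpM2l ?cabs_ge0 // prod_normE le_max lexx orbT.
rewrite -mulrA mulrCA ler_wpM2l ?cabs_ge0 //.
apply: (le_trans (cabs_cpt_le _)).
by rewrite ler_wpM2l // [leRHS]prod_normE le_max lexx.
Qed.

Lemma strictly_diff_lip f p0 a b : strictly_diff f p0 a b ->
  exists2 K, 0 < K &
    \forall pq \near filter_prod (nbhs p0) (nbhs p0),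
      cabs (f pq.1 - f pq.2) <= K * `|pq.1 - pq.2|.
Proof.
move=> fd; exists (1 + (2 * cabs a + cabs b)).
  by rewrite ltr_wpDr // addr_ge0 ?mulr_ge0 ?cabs_ge0.
have := fd 1 ltr01; apply: filterS => -[p q] /= H.
rewrite mulrDl; apply: le_trans (lerD H (cabs_linear_le a b (p - q))).
by apply: le_trans (cabsD _ _); rewrite /= subrK.
Qed.

Lemma strictly_diff_cont f p0 a b : strictly_diff f p0 a b ->
  forall e : R, 0 < e -> \forall p \near p0, cabs (f p - f p0) <= e.
Proof.
move=> /strictly_diff_lip [K K0 fK] e e0.
have c : (fun p => (p, p0)) @ p0 --> filter_prod (nbhs p0) (nbhs p0).
  by apply: (@cvg_pair _ _ _ (nbhs p0) (nbhs p0) (nbhs p0));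
    [exact: cvg_id | exact: cvg_cst].
have {}fK : \forall p \near p0, cabs (f p - f p0) <= K * `|p - p0| := c _ fK.
near=> p.
have H : cabs (f p - f p0) <= K * `|p - p0| by near: p; exact: fK.
apply: (le_trans H); rewrite mulrC -ler_pdivlMr //.
near: p; apply/nbhs_ballP; exists (e / K) => /=; first exact: divr_gt0.
by move=> p; rewrite -ball_normE /= distrC => /ltW.
Unshelve. all: end_near. Qed.

Lemma strictly_diff_cst (c : R[i]) p0 : strictly_diff (fun=> c) p0 0 0.
Proof.
move=> e e0; apply: nearW => -[p q] /=.
by rewrite subrr !mul0r addr0 subr0 cabs0 mulr_ge0 // ltW.
Qed.

Lemma strictly_diff_fst p0 : strictly_diff (fun p => cpt p.1) p0 1 0.
Proof.
move=> e e0; apply: nearW => -[p q] /=.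
by rewrite mul1r mul0r addr0 cptB subrr cabs0 mulr_ge0 // ltW.
Qed.

Lemma strictly_diff_snd p0 : strictly_diff (fun p => p.2%:C) p0 0 1.
Proof.
move=> e e0; apply: nearW => -[p q] /=.
by rewrite mul1r mul0r add0r rmorphB subrr cabs0 mulr_ge0 // ltW.
Qed.

Lemma strictly_diffD f g p0 a b a' b' :
  strictly_diff f p0 a b -> strictly_diff g p0 a' b' ->
  strictly_diff (fun p => f p + g p) p0 (a + a') (b + b').
Proof.
move=> fd gd e e0; have e20 : 0 < e / 2 by rewrite divr_gt0.
apply: filterS2 (fd _ e20) (gd _ e20) => -[p q] /= H1 H2.
rewrite [in leRHS](splitr e) (mulrDl (e / 2)).
apply: le_trans (lerD H1 H2).
rewrite (le_trans _ (cabsD _ _)) // le_eqVlt; apply/orP; left; apply/eqP.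
by congr cabs; ring.
Qed.

Lemma strictly_diffM f g p0 a b a' b' :
  strictly_diff f p0 a b -> strictly_diff g p0 a' b' ->
  strictly_diff (fun p => f p * g p) p0
    (a * g p0 + f p0 * a') (b * g p0 + f p0 * b').
Proof.
move=> fd gd e e0.
have [K K0 fK] := strictly_diff_lip fd.
have [K' K0' gK] := strictly_diff_lip gd.
(* The error splits into four terms whose coefficients add up to [M], so each is estimated with
   precision [e / M]. *)
pose M := K + K' + cabs (f p0) + cabs (g p0).
have M0 : 0 < M by rewrite /M !ltr_pwDl ?addr_ge0 ?cabs_ge0 // ltW.
have d0 : 0 < e / M by rewrite divr_gt0.
have c1 : fst @ filter_prod (nbhs p0) (nbhs p0) --> p0 by exact: cvg_fst.
have c2 : snd @ filter_prod (nbhs p0) (nbhs p0) --> p0 by exact: cvg_snd.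
have h3 : \forall pq \near filter_prod (nbhs p0) (nbhs p0),
    cabs (f pq.1 - f p0) <= e / M :=
  c1 _ (strictly_diff_cont fd d0).
have h4 : \forall pq \near filter_prod (nbhs p0) (nbhs p0),
    cabs (g pq.2 - g p0) <= e / M :=
  c2 _ (strictly_diff_cont gd d0).
near=> pq.
have H1 : cabs (f pq.1 - f pq.2 - (a * cpt (pq.1.1 - pq.2.1)
    + b * (pq.1.2 - pq.2.2)%:C)) <= e / M * `|pq.1 - pq.2|.
  by near: pq; exact: fd.
have H2 : cabs (g pq.1 - g pq.2 - (a' * cpt (pq.1.1 - pq.2.1)
    + b' * (pq.1.2 - pq.2.2)%:C)) <= e / M * `|pq.1 - pq.2|.
  by near: pq; exact: gd.
have H3 : cabs (f pq.1 - f p0) <= e / M by near: pq; exact: h3.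
have H4 : cabs (g pq.2 - g p0) <= e / M by near: pq; exact: h4.
have H5 : cabs (f pq.1 - f pq.2) <= K * `|pq.1 - pq.2| by near: pq; exact: fK.
have H6 : cabs (g pq.1 - g pq.2) <= K' * `|pq.1 - pq.2| by near: pq; exact: gK.
set z := cpt _ in H1 H2 *; set t := (_ - _)%:C in H1 H2 *.
set N := `|_| in H1 H2 H5 H6 *.
have -> : f pq.1 * g pq.1 - f pq.2 * g pq.2
    - ((a * g p0 + f p0 * a') * z + (b * g p0 + f p0 * b') * t)
  = (f pq.1 - f p0) * (g pq.1 - g pq.2)
    + f p0 * (g pq.1 - g pq.2 - (a' * z + b' * t))
    + (g pq.2 - g p0) * (f pq.1 - f pq.2)
    + g p0 * (f pq.1 - f pq.2 - (a * z + b * t)) by ring.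
have -> : e * N = e / M * (K' * N) + cabs (f p0) * (e / M * N)
    + e / M * (K * N) + cabs (g p0) * (e / M * N).
  rewrite -[in LHS](divfK (lt0r_neq0 M0) e) {2}/M; ring.
do 3![apply: (le_trans (cabsD _ _)); apply: lerD;
  last by rewrite cabsM ler_pM ?cabs_ge0].
by rewrite cabsM ler_pM ?cabs_ge0.
Unshelve. all: end_near. Qed.

End StrictDiff.

(** * Real derivatives as little-o estimates, and the differential of exponentials and
    polynomials *)

Section DeriveNear.
Local Open Scope complex_scope.
Local Open Scope classical_set_scope.
Variable R : realType.

(** Multiplying the difference quotient by the increment gives a form that also makes sense at
    [y = x] and matches the estimates of [strictly_diff]. *)
Lemma is_derive_nearP (f : R -> R) (x df : R) :
  is_derive x 1 f df <->
  forall e, 0 < e -> \forall y \near x, `|f y - f x - df * (y - x)| <= e * `|y - x|.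
Proof.
have E h : h != 0 -> forall df e, (`|df - h^-1 *: (f (h *: 1 + x) - f x)| <= e) =
    (`|f (h + x) - f x - df * h| <= e * `|h|).
  move=> h0 d e; rewrite -ler_pdivrMr ?normr_gt0 // -normf_div distrC.
  rewrite /GRing.scale /= mulr1; congr (`|_| <= _).
  by rewrite mulrBl mulfK // mulrC.
split=> [[fd <-] e e0|H].
  have /cvgrPdist_le/(_ e e0)/nbhs_ballP [d /= d0 dP] := fd.
  apply/nbhs_ballP; exists d => //= y; rewrite -ball_normE /= => xy.
  have [->|yx] := eqVneq y x; first by rewrite !subrr mulr0 subr0 normr0 mulr0.
  have yx0 : y - x != 0 by rewrite subr_eq0.
  have yB : ball 0 d (y - x) by rewrite -ball_normE /= sub0r normrN distrC.
  by have := dP _ yB yx0; rewrite E // subrK.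
have c : h^-1 *: (f (h *: 1 + x) - f x) @[h --> 0^'] --> df.
  apply/cvgrPdist_le => e e0.
  have /nbhs_ballP [d /= d0 dP] := H e e0.
  apply/nbhs_ballP; exists d => //= h; rewrite -ball_normE /= sub0r normrN => hd h0.
  rewrite E //; have := dP (h + x); rewrite -ball_normE /= => /(_ _).
  by rewrite opprD addrCA subrr addr0 normrN addrK; apply.
by apply: DeriveDef; [exact: cvgP c | exact: cvg_lim c].
Qed.

Lemma cexpD (x y : R[i]) : cexp (x + y) = cexp x * cexp y.
Proof.
case: x y => [a b] [c d]; rewrite /cexp /= expRD cosD sinD.
by apply/eqP; rewrite eq_complex /=; apply/andP; split; apply/eqP; ring.
Qed.

(** The real and imaginary parts of the remainder are combinations of the first-order remainders of
    the real functions exp, cos and sin at 0. *)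
Lemma cexp_sub1_near (e : R) : 0 < e -> exists2 d, 0 < d &
  forall h : R[i], cabs h < d -> cabs (cexp h - 1 - h) <= e * cabs h.
Proof.
(* Of the four error terms two carry a factor [expR x], bounded by 2, and two do not: six times
   [e / 6] in all. *)
move=> e0; have e60 : 0 < e / 6 by rewrite divr_gt0.
have dexp := (is_derive_nearP expR 0 _).1 (is_derive_expR 0) _ e60.
have dcos := (is_derive_nearP cos 0 _).1 (is_derive_cos 0) _ e60.
have dsin := (is_derive_nearP sin 0 _).1 (is_derive_sin 0) _ e60.
have cexpR : {for (0 : R), continuous (@expR R)} by exact: continuous_expR.
have /cvgrPdist_le cR := cexpR.
have m0 : 0 < Num.min 1 (e / 6) by rewrite lt_min ltr01.
have F : nbhs (0 : R) _ := filterI (filterI dexp dcos) (filterI dsin (cR _ m0)).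
have [d /= d0 dP] := (nbhs_ballP _ _).1 (F _ _ _).
exists d => // h hd.
have dP' (x : R) : `|x| <= cabs h -> ball 0 d x.
  by move=> xh; rewrite -ball_normE /= sub0r normrN (le_lt_trans xh).
have [[HE _] [_]] := dP _ (dP' _ (Re_le_cabs h)).
have [[_ HC] [HS _]] := dP _ (dP' _ (Im_le_cabs h)).
move: HE HC HS; rewrite expR0 cos0 sin0 !subr0 oppr0 !mul0r !mul1r !subr0 => HE HC HS.
have hr := Re_le_cabs h; have hi := Im_le_cabs h.
rewrite distrC le_min => /andP[H1 H2].
set x := complex.Re h in HE hr H1 H2; set y := complex.Im h in HC HS hi.
have X0 : `|expR x| <= 2.
  by rewrite -[expR x](subrK 1) (le_trans (ler_normD _ _)) // normr1 lerD.
apply: (le_trans (cabs_le_ReIm _)).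
have -> : complex.Re (cexp h - 1 - h) = (expR x - 1 - x) + expR x * (cos y - 1).
  rewrite /x /y; move: (h) => [u v] /=; ring.
have -> : complex.Im (cexp h - 1 - h) = expR x * (sin y - y) + (expR x - 1) * y.
  rewrite /x /y; move: (h) => [u v] /=; ring.
have e6 : 0 <= e / 6 by exact: ltW.
have B1 : `|expR x * (cos y - 1)| <= 2 * (e / 6 * cabs h).
  by rewrite normrM ler_pM // (le_trans HC) // ler_wpM2l //.
have B2 : `|expR x * (sin y - y)| <= 2 * (e / 6 * cabs h).
  by rewrite normrM ler_pM // (le_trans HS) // ler_wpM2l //.
have B3 : `|(expR x - 1) * y| <= e / 6 * cabs h by rewrite normrM ler_pM.
have B4 : `|expR x - 1 - x| <= e / 6 * cabs h.
  by rewrite (le_trans HE) // ler_wpM2l //.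
have := ler_normD (expR x - 1 - x) (expR x * (cos y - 1)).
have := ler_normD (expR x * (sin y - y)) ((expR x - 1) * y).
lra.
Qed.

Lemma cexp_cont (w0 : R[i]) (e : R) : 0 < e -> exists2 d, 0 < d &
  forall w : R[i], cabs (w - w0) < d -> cabs (cexp w - cexp w0) <= e.
Proof.
move=> e0; have [d d0 dP] := cexp_sub1_near ltr01.
(* The factor 2 comes from |exp h - 1| <= 2 |h| for small h; the added 1 only keeps [M] positive. *)
pose M := 2 * (cabs (cexp w0) + 1).
have M0 : 0 < M by rewrite mulr_gt0 // ltr_wpDl // cabs_ge0.
exists (Num.min d (e / M)); first by rewrite lt_min d0 divr_gt0.
move=> w; rewrite lt_min => /andP[wd wM].
have -> : cexp w - cexp w0 = cexp w0 * (cexp (w - w0) - 1).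
  by rewrite mulrBr mulr1 -cexpD addrCA subrr addr0.
rewrite cabsM.
have H : cabs (cexp (w - w0) - 1) <= 2 * cabs (w - w0).
  rewrite -[_ - 1](subrK (w - w0)) (le_trans (cabsD _ _)) // mulrDl lerD //.
    exact: dP.
  by rewrite mul1r.
apply: (@le_trans _ _ ((cabs (cexp w0) + 1) * (2 * (e / M)))).
  rewrite ler_pM ?cabs_ge0 ?lerDl // (le_trans H) // ler_wpM2l // ltW //.
by rewrite mulrA [_ * 2]mulrC -/M mulrC divfK // gt_eqF.
Qed.

Lemma near_filter_prodP (T : normedModType R) (p0 : T) (P : T * T -> Prop) :
  (\forall pq \near filter_prod (nbhs p0) (nbhs p0), P pq) ->
  exists2 r : R, 0 < r & forall p q, `|p - p0| < r -> `|q - p0| < r -> P (p, q).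
Proof.
move=> -[[A B] /= [nA nB] AB].
have F : nbhs p0 _ := filterI nA nB.
have [r /= r0 rP] := (nbhs_ballP _ _).1 (F _).
exists r => // p q pr qr; apply: AB; split => /=.
  by have [] := rP p; rewrite -?ball_normE /= 1?distrC.
by have [] := rP q; rewrite -?ball_normE /= 1?distrC.
Qed.

(** With h = f p - f q one has exp(f p) - exp(f q) = exp(f q) (exp h - 1). Here h is small and of
    Lipschitz size in p - q, and exp(f q) is close to exp(f p0). *)
Lemma strictly_diff_cexp (f : R * R * R -> R[i]) p0 a b :
  strictly_diff f p0 a b ->
  strictly_diff (fun p => cexp (f p)) p0 (cexp (f p0) * a) (cexp (f p0) * b).
Proof.
move=> fd e e0.
have [K K0 fK] := strictly_diff_lip fd.
set E0 := cexp (f p0).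
pose M := (cabs E0 + 1) * K + K + cabs E0.
have M0 : 0 < M.
  by rewrite /M ltr_wpDr ?cabs_ge0 // ltr_wpDl // mulr_ge0 ?ltW // ltr_wpDl ?cabs_ge0.
have d0 : 0 < e / M by rewrite divr_gt0.
have m0 : 0 < Num.min 1 (e / M) by rewrite lt_min ltr01.
have [d1 d10 H1] := cexp_sub1_near d0.
have [d2 d20 H2] := cexp_cont (f p0) m0.
have c1 : fst @ filter_prod (nbhs p0) (nbhs p0) --> p0 by exact: cvg_fst.
have c2 : snd @ filter_prod (nbhs p0) (nbhs p0) --> p0 by exact: cvg_snd.
have d10' : 0 < d1 / 3 by rewrite divr_gt0.
have d20' : 0 < d2 / 2 by rewrite divr_gt0.
have h1 : \forall pq \near filter_prod (nbhs p0) (nbhs p0),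
    cabs (f pq.1 - f p0) <= d1 / 3 := c1 _ (strictly_diff_cont fd d10').
have h2 : \forall pq \near filter_prod (nbhs p0) (nbhs p0),
    cabs (f pq.2 - f p0) <= d1 / 3 := c2 _ (strictly_diff_cont fd d10').
have h3 : \forall pq \near filter_prod (nbhs p0) (nbhs p0),
    cabs (f pq.2 - f p0) <= d2 / 2 := c2 _ (strictly_diff_cont fd d20').
near=> pq.
have G1 : cabs (f pq.1 - f pq.2 - (a * cpt (pq.1.1 - pq.2.1)
    + b * (pq.1.2 - pq.2.2)%:C)) <= e / M * `|pq.1 - pq.2|.
  by near: pq; exact: fd.
have G2 : cabs (f pq.1 - f pq.2) <= K * `|pq.1 - pq.2| by near: pq; exact: fK.
have G3 : cabs (f pq.1 - f p0) <= d1 / 3 by near: pq; exact: h1.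
have G4 : cabs (f pq.2 - f p0) <= d1 / 3 by near: pq; exact: h2.
have G5 : cabs (f pq.2 - f p0) <= d2 / 2 by near: pq; exact: h3.
have G6 : cabs (f pq.1 - f pq.2) < d1.
  have -> : f pq.1 - f pq.2 = (f pq.1 - f p0) - (f pq.2 - f p0) by ring.
  apply: (le_lt_trans (cabsD _ _)); rewrite cabsN.
  by apply: (le_lt_trans (lerD G3 G4)); lra.
have G7 := H1 _ G6.
have : cabs (cexp (f pq.2) - E0) <= Num.min 1 (e / M).
  by apply: H2; apply: (le_lt_trans G5); lra.
rewrite le_min => /andP[G8 G9].
have G10 : cabs (cexp (f pq.2)) <= cabs E0 + 1.
  rewrite -[cexp (f pq.2)](subrK E0) [leRHS]addrC.
  by apply: (le_trans (cabsD _ _)); rewrite lerD.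
set z := cpt _ in G1 *; set t := (_ - _)%:C in G1 *.
set N := `|_| in G1 G2 *; set h := f pq.1 - f pq.2 in G1 G2 G6 G7 *.
have -> : cexp (f pq.1) - cexp (f pq.2) - (E0 * a * z + E0 * b * t)
  = cexp (f pq.2) * (cexp h - 1 - h) + (cexp (f pq.2) - E0) * h
    + E0 * (h - (a * z + b * t)).
  have -> : f pq.1 = f pq.2 + h by rewrite /h; ring.
  by rewrite cexpD; ring.
have -> : e * N = (cabs E0 + 1) * (e / M * (K * N)) + e / M * (K * N)
    + cabs E0 * (e / M * N).
  rewrite -[in LHS](divfK (lt0r_neq0 M0) e) {2}/M; ring.
have G11 : cabs (cexp h - 1 - h) <= e / M * (K * N).
  by rewrite (le_trans G7) // ler_wpM2l // ltW.
do 2![apply: (le_trans (cabsD _ _)); apply: lerD;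
  last by rewrite cabsM ler_pM ?cabs_ge0].
by rewrite cabsM ler_pM ?cabs_ge0.
Unshelve. all: end_near. Qed.

Lemma strictly_diff_eq (f g : R * R * R -> R[i]) p0 a b a' b' :
  strictly_diff f p0 a b -> f =1 g -> a = a' -> b = b' ->
  strictly_diff g p0 a' b'.
Proof. by move=> fd /funext <- <- <-. Qed.

Lemma strictly_diff_horner (c : {poly R[i]}) (f : R * R * R -> R[i]) p0 a b :
  strictly_diff f p0 a b ->
  strictly_diff (fun p => c.[f p]) p0 (c^`().[f p0] * a) (c^`().[f p0] * b).
Proof.
move=> fd; elim/poly_ind: c => [|c k IH].
  apply: strictly_diff_eq (strictly_diff_cst 0 p0) _ _ _ => [p||];
    by rewrite ?deriv0 ?horner0 ?mul0r.
apply: strictly_diff_eq (strictly_diffD (strictly_diffM IH fd)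
    (strictly_diff_cst k p0)) _ _ _ => [p||].
- by rewrite hornerMXaddC.
- by rewrite !(derivD, derivM, derivX, derivC, addr0, mulr1) !(hornerD, hornerM, hornerX); ring.
- by rewrite !(derivD, derivM, derivX, derivC, addr0, mulr1) !(hornerD, hornerM, hornerX); ring.
Qed.

(** The chain rule for P(f, g): induction on the degree in the outer variable, with the one-variable
    rule for the coefficients. *)
Lemma strictly_diff_horner2 (P : {poly {poly R[i]}}) (f g : R * R * R -> R[i])
    p0 a b a' b' :
  strictly_diff f p0 a b -> strictly_diff g p0 a' b' ->
  strictly_diff (fun p => P.[(f p)%:P].[g p]) p0
    (P^`().[(f p0)%:P].[g p0] * a + P.[(f p0)%:P]^`().[g p0] * a')
    (P^`().[(f p0)%:P].[g p0] * b + P.[(f p0)%:P]^`().[g p0] * b').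
Proof.
move=> fd gd; elim/poly_ind: P => [|P c IH].
  apply: strictly_diff_eq (strictly_diff_cst 0 p0) _ _ _ => [p||];
    by rewrite ?deriv0 ?horner0 ?deriv0 ?horner0 ?mul0r ?addr0.
apply: strictly_diff_eq (strictly_diffD (strictly_diffM IH fd)
    (strictly_diff_horner c gd)) _ _ _ => [p||].
- by rewrite hornerMXaddC hornerD hornerM hornerC.
- rewrite hornerMXaddC !(derivD, derivM, derivX, derivC, addr0, mulr1, mulr0).
  by rewrite !(hornerD, hornerM, hornerX, hornerC); ring.
- rewrite hornerMXaddC !(derivD, derivM, derivX, derivC, addr0, mulr1, mulr0).
  by rewrite !(hornerD, hornerM, hornerX, hornerC); ring.
Qed.

End DeriveNear.

(** * An implicit function theorem by contraction *)

Section ImplicitFunction.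
Local Open Scope complex_scope.
Local Open Scope classical_set_scope.
Variable R : realType.

Definition cpt_of (w : R[i]) : R * R := (complex.Re w, complex.Im w).

Lemma cpt_ofK w : cpt (cpt_of w) = w. Proof. by case: w. Qed.

Lemma prod_norm_le (u : R * R) (t : R) : `|(u, t)| <= `|u| + `|t|.
Proof. by rewrite prod_normE ge_max lerDl lerDr !normr_ge0. Qed.

(** For fixed t the zeros of f are the fixed points of the simplified Newton map z - f(z, t) / a, a
    contraction of a small closed ball. The two-point estimate applied to two zeros gives uniqueness
    and Lipschitz dependence on t, and then the derivative - b / a at [t0]. *)
Lemma implicit_function (f : R * R * R -> R[i]) (z0 : R * R) (t0 : R) (a b : R[i]) :
  strictly_diff f (z0, t0) a b -> f (z0, t0) = 0 -> a != 0 ->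
  exists zeta : R -> R * R,
    [/\ zeta t0 = z0,
        \forall t \near t0, f (zeta t, t) = 0,
        \forall t \near t0, {for t, continuous zeta} &
        forall e : R, 0 < e -> \forall t \near t0,
          cabs (cpt (zeta t) - cpt z0 - - (b / a) * (t - t0)%:C) <= e * `|t - t0|].
Proof.
move=> fd f0 a0.
have ca0 : 0 < cabs a by rewrite cabs_gt0.
(* The contraction ratio will be [e0 / c], that is 1/8. *)
pose c := cabs a; pose e0 := c / 8.
have e00 : 0 < e0 by rewrite divr_gt0.
have [r r0 rP] := near_filter_prodP (fd _ e00).
pose rho := r / 2; have rho0 : 0 < rho by rewrite divr_gt0.
have rhor : rho < r by rewrite /rho; lra.
pose B := cabs b; have B0 : 0 <= B by exact: cabs_ge0.
(* The second bound makes a change of t displace the Newton map by at most [rho / 2], so that the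
   ball of radius [rho] is mapped into itself. *)
pose s := Num.min r (rho * c / (2 * (B + e0))).
have Be0 : 0 < B + e0 by rewrite ltr_wpDl.
have s0 : 0 < s by rewrite lt_min r0 divr_gt0 ?mulr_gt0.
have ball_lt (z : R * R) (t : R) : `|z - z0| <= rho -> `|t - t0| < s ->
    `|(z, t) - (z0, t0)| < r.
  move=> zr; rewrite lt_min => /andP[tr _].
  by rewrite prod_normE /= gt_max tr (le_lt_trans zr).
have est z t z' t' : `|z - z0| <= rho -> `|t - t0| < s ->
    `|z' - z0| <= rho -> `|t' - t0| < s ->
    cabs (f (z, t) - f (z', t') - (a * cpt (z - z') + b * (t - t')%:C))
      <= e0 * (`|z - z'| + `|t - t'|).
  move=> zr ts zr' ts'.
  have := rP _ _ (ball_lt _ _ zr ts) (ball_lt _ _ zr' ts') => /= H.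
  apply: (le_trans H); rewrite ler_wpM2l ?(ltW e00) //.
  exact: prod_norm_le.
(* For two zeros, c |z - z'| <= e0 |z - z'| + (B + e0) |t - t'|; the first term on the right is
   absorbed on the left since [e0] is [c / 8]. *)
pose L := 2 * (B + e0) / c.
have L0 : 0 < L by rewrite divr_gt0 // mulr_gt0.
have lip z t z' t' : `|z - z0| <= rho -> `|t - t0| < s ->
    `|z' - z0| <= rho -> `|t' - t0| < s -> f (z, t) = 0 -> f (z', t') = 0 ->
    `|z - z'| <= L * `|t - t'|.
  move=> zr ts zr' ts' fz fz'; have := est _ _ _ _ zr ts zr' ts'.
  rewrite fz fz' subrr sub0r cabsN => H.
  have H1 : c * cabs (cpt (z - z')) <= e0 * (`|z - z'| + `|t - t'|) + B * `|t - t'|.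
    rewrite -cabsM -[a * _](addrK (b * (t - t')%:C)).
    by rewrite (le_trans (cabsD _ _)) // cabsN cabsM cabs_real lerD.
  have H2 : c * `|z - z'| <= c * cabs (cpt (z - z')).
    by rewrite ler_wpM2l ?cabs_cpt_ge // ltW.
  have H3 : c * `|z - z'| <= e0 * (`|z - z'| + `|t - t'|) + B * `|t - t'|.
    exact: le_trans H2 H1.
  rewrite /L mulrAC ler_pdivlMr // mulrC.
  have H4 : e0 * `|z - z'| = c * `|z - z'| / 8 by rewrite /e0; field.
  have H5 : 0 <= c * `|z - z'| by rewrite mulr_ge0 // ltW.
  move: H3; rewrite mulrDr H4 -mulrA mulrDl; lra.
(* The condition on t is put under the existential so that [choice] returns a total function; far
   from [t0] its value is arbitrary. *)
have fix_ex t : exists z, `|t - t0| < s -> `|z - z0| <= rho /\ f (z, t) = 0.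
  have [ts|] := boolP (`|t - t0| < s); last by exists z0.
  pose N (z : R * R) : R * R := z - cpt_of (f (z, t) / a).
  have NE z z' : cpt (N z - z') = cpt (z - z') - f (z, t) / a.
    by rewrite /N addrAC [LHS]cptB cpt_ofK.
  pose U := [set z : R * R | `|z - z0| <= rho].
  have NU : {homo N : z / U z >-> U z}.
    move=> z zU; rewrite /U /=; apply: (le_trans (cabs_cpt_ge _)); rewrite NE.
    have z00 : `|z0 - z0| <= rho by rewrite subrr normr0 ltW.
    have t00 : `|t0 - t0| < s by rewrite subrr normr0.
    have := est _ _ _ _ zU ts z00 t00; rewrite f0 subr0 => H.
    have H1 : c * cabs (cpt (z - z0) - f (z, t) / a)
        <= e0 * (`|z - z0| + `|t - t0|) + B * `|t - t0|.
      rewrite -cabsM.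
      have -> : a * (cpt (z - z0) - f (z, t) / a) =
        - (f (z, t) - (a * cpt (z - z0) + b * (t - t0)%:C)) - b * (t - t0)%:C.
        by field.
      rewrite (le_trans (cabsD _ _)) // !cabsN cabsM cabs_real lerD //.
    rewrite -(ler_pM2l ca0) (le_trans H1) //.
    move: ts; rewrite lt_min => /andP[_].
    rewrite ltr_pdivlMr ?mulr_gt0 // => H2.
    have H3 : e0 * `|z - z0| <= e0 * rho by rewrite ler_wpM2l // ltW.
    have H4 : e0 * rho = c * rho / 8 by rewrite /e0; field.
    have H5 : 0 < c * rho by rewrite mulr_gt0.
    rewrite mulrDr; rewrite -/c; lra.
  have Nc : is_contraction (mkfun_fun NU).
    exists (1 / 8)%:nng; split => /=; first by lra.
    move=> -[z z'] /= [zU zU'].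
    apply: (le_trans (cabs_cpt_ge _)).
    have -> : cpt (N z - N z') = cpt (z - z') - (f (z, t) - f (z', t)) / a.
      by rewrite NE (cptB z (N z')) (cptB z z') [cpt (N z')]cptB cpt_ofK; field.
    have := est _ _ _ _ zU ts zU' ts.
    rewrite !subrr normr0 addr0 mulr0 addr0 => H.
    rewrite -(ler_pM2l ca0) -cabsM.
    have -> : a * (cpt (z - z') - (f (z, t) - f (z', t)) / a) =
      - (f (z, t) - f (z', t) - a * cpt (z - z')) by field.
    rewrite cabsN (le_trans H) // /e0 /c le_eqVlt; apply/orP; left; apply/eqP.
    by field.
  have Ucl : closed U.
    have -> : U = closed_ball z0 rho.
      rewrite closed_ballE //; apply/seteqP; split => z; by rewrite /U /closed_ball_ /= distrC.
    exact: closed_ball_closed.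
  have U0 : U !=set0 by exists z0; rewrite /U /= subrr normr0 ltW.
  have [z zU zN] := banach_fixed_point Nc Ucl U0.
  exists z => _; split=> //.
  have := NE z z; rewrite -[N z]zN subrr cpt0 sub0r => /esym/eqP.
  by rewrite oppr_eq0 mulf_eq0 invr_eq0 (negbTE a0) orbF => /eqP.
have [zeta zP] := choice fix_ex.
have t00 : `|t0 - t0| < s by rewrite subrr normr0.
have z00 : `|z0 - z0| <= rho by rewrite subrr normr0 ltW.
have zt0 : zeta t0 = z0.
  (* Both [zeta t0] and [z0] are zeros at time [t0], so the Lipschitz bound at equal times
     identifies them. *)
  have [H1 H2] := zP _ t00.
  have := lip _ _ _ _ H1 t00 z00 t00 H2 f0.
  by rewrite subrr normr0 mulr0 normr_le0 subr_eq0 => /eqP.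
have near_s : \forall t \near t0, `|t - t0| < s.
  by apply/nbhs_ballP; exists s => //= t; rewrite -ball_normE /= distrC.
have zlip t t' : `|t - t0| < s -> `|t' - t0| < s ->
    `|zeta t - zeta t'| <= L * `|t - t'|.
  move=> ts ts'; have [H1 H2] := zP _ ts; have [H1' H2'] := zP _ ts'.
  exact: lip.
exists zeta; split => //.
- by apply: filterS near_s => t /zP[].
- apply/nbhs_ballP; exists s => //= t; rewrite -ball_normE /= distrC => ts.
  apply/cvgrPdist_le => e e0'.
  apply/nbhs_ballP; exists (Num.min (s - `|t - t0|) (e / L)) => /=.
    by rewrite lt_min subr_gt0 ts divr_gt0.
  move=> t' /=; rewrite lt_min => /andP[H1 H2].
  have ts' : `|t' - t0| < s.
    have -> : t' - t0 = (t' - t) + (t - t0) by ring.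
    by rewrite (le_lt_trans (ler_normD _ _)) // -ltrBrDr distrC.
  apply: (le_trans (zlip _ _ ts ts')).
  by rewrite mulrC -ler_pdivlMr // ltW.
- move=> e ep.
  (* The point (zeta t, t) is within (L + 1) |t - t0| of the base point, and the final estimate is
     divided by |a| = c. *)
  have e1p : 0 < e * c / (L + 1) by rewrite divr_gt0 ?mulr_gt0 // addr_gt0.
  have [d d0 dP] := near_filter_prodP (fd _ e1p).
  apply/nbhs_ballP; exists (Num.min s (d / (L + 1))) => /=.
    by rewrite lt_min s0 divr_gt0 // addr_gt0.
  move=> t; rewrite -ball_normE /= lt_min distrC => /andP[ts].
  have L1 : 0 < L + 1 by rewrite addr_gt0.
  rewrite ltr_pdivlMr // => td.
  have Hn : `|(zeta t, t) - (z0, t0)| <= (L + 1) * `|t - t0|.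
    apply: (le_trans (prod_norm_le _ _)) => /=.
    rewrite mulrDl mul1r lerD // -zt0; exact: zlip.
  have Hd : `|(zeta t, t) - (z0, t0)| < d.
    by apply: (le_lt_trans Hn); rewrite mulrC.
  have d00 : `|(z0, t0) - (z0, t0)| < d by rewrite subrr normr0.
  have := dP _ _ Hd d00; rewrite f0 (zP _ ts).2 subrr sub0r cabsN /= => H.
  rewrite -(ler_pM2l ca0) -cabsM.
  have -> : a * (cpt (zeta t) - cpt z0 - - (b / a) * (t - t0)%:C) =
    a * cpt (zeta t - z0) + b * (t - t0)%:C by rewrite cptB; field.
  apply: (le_trans H).
  apply: (@le_trans _ _ (e * c / (L + 1) * ((L + 1) * `|t - t0|))).
    by rewrite ler_wpM2l // ltW.
  rewrite mulrA divfK ?gt_eqF // -/c.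
  by rewrite [e * c]mulrC mulrA.
Qed.

End ImplicitFunction.

(** * The characteristic function as a polynomial in two variables *)

Section CharPoly.
Local Open Scope complex_scope.
Local Open Scope classical_set_scope.
Variables (R : realType) (n : nat) (A B : 'M[R]_n).
Notation cmx := (map_mx (real_complex R)).

(** This is P(l, Y) with l as outer variable ['X] and Y as inner variable ['X%:P]: powers of l - i
    omega can be divided out, and [.[l%:P]] leaves a polynomial in Y. *)
Definition char_poly2 : {poly {poly R[i]}} :=
  \det ('X%:M - map_mx polyC (map_mx polyC (cmx A))
        - ('X%:P) *: map_mx polyC (map_mx polyC (cmx B))).

Lemma horner_char_poly2 (l : R[i]) :
  char_poly2.[l%:P] = \det (map_mx polyC (l%:M - cmx A) - 'X *: map_mx polyC (cmx B)).
Proof.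
rewrite -[LHS]/(horner_eval l%:P char_poly2) -det_map_mx; congr (\det _).
apply/matrixP => i k; rewrite !mxE -[LHS]/((_ : {poly {poly R[i]}}).[l%:P]).
by rewrite !(hornerD, hornerN, hornerM, hornerC, hornerMn, hornerX) rmorphB rmorphMn.
Qed.

Lemma horner2_char_poly2 (l y : R[i]) :
  char_poly2.[l%:P].[y] = \det (l%:M - cmx A - y *: cmx B).
Proof.
rewrite horner_char_poly2 -[LHS]/(horner_eval y _) -det_map_mx; congr (\det _).
apply/matrixP => i k; rewrite !mxE -[LHS]/((_ : {poly R[i]}).[y]).
by rewrite !(hornerD, hornerN, hornerM, hornerC, hornerMn, hornerX).
Qed.

Lemma genpolyE omega : genpoly A B omega = char_poly2.[(0 +i* omega)%:P].
Proof. by rewrite horner_char_poly2. Qed.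

Lemma char_funE tau l :
  char_fun A B tau l = char_poly2.[l%:P].[cexp (- (l * tau%:C))].
Proof. by rewrite horner2_char_poly2. Qed.

(** Holds because A and B are real; it supplies the conjugate characteristic root and transfers
    statements from - omega to omega. *)
Lemma char_poly2_conj (l y : R[i]) :
  char_poly2.[(l^*%C)%:P].[y^*%C] = (char_poly2.[l%:P].[y])^*%C.
Proof.
rewrite !horner2_char_poly2 -det_map_mx; congr (\det _).
by apply/matrixP => i k; rewrite !mxE !rmorphB rmorphM rmorphMn /= oppr0.
Qed.

(** A constant polynomial equals its value at Y = 0, where the matrix B drops out. *)
Lemma degenerateP omega : degenerate A B omega <-> (size (genpoly A B omega) <= 1)%N.
Proof.
split=> [->|H]; first exact: size_polyC_leq1.
rewrite /degenerate {1}(size1_polyC H); congr _%:P.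
by rewrite -horner_coef0 genpolyE horner2_char_poly2 scale0r subr0.
Qed.

Lemma nondegenerateP omega : ~ degenerate A B omega <-> (1 < size (genpoly A B omega))%N.
Proof.
split=> [H|H /degenerateP]; last by rewrite leqNgt H.
by rewrite ltnNge; apply/negP => /degenerateP.
Qed.

Lemma coef_horner_polyC (P : {poly {poly R[i]}}) (l : R[i]) k :
  (P.[l%:P])`_k = (map_poly (coefp k) P).[l].
Proof.
rewrite horner_coef coef_sum /map_poly horner_poly.
by apply: eq_bigr => i _; rewrite -polyC_exp coefMC.
Qed.

End CharPoly.

(** * Moduli of the branches of the spectrum *)

Section Branches.
Local Open Scope complex_scope.
Local Open Scope classical_set_scope.
Variable R : realType.

Lemma acs_gammaE (y : R[i]) : acs_gamma (Some y) = (- lne (cabs y)%:E)%E.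
Proof. by []. Qed.

Lemma acs_gamma_eq0 (y : R[i]) : acs_gamma (Some y) = 0%E <-> cabs y = 1.
Proof.
rewrite acs_gammaE; split=> [/eqP|->]; last by rewrite lne1 oppe0.
by rewrite oppe_eq0 lne_eq0 => /eqP[].
Qed.

Lemma acs_gamma_gt (y : option R[i]) (c : R) :
  (c%:E < acs_gamma y)%E -> exists2 z, y = Some z & cabs z < expR (- c).
Proof.
case: y => [z|] //; rewrite acs_gammaE lteNr.
rewrite -[(- c%:E)%E]/((- c)%:E) -[in (- c)%:E](expRK (- c)) -lne_EFin ?expR_gt0 //.
rewrite lte_lne ?in_itv /= ?lee_fin ?cabs_ge0 ?expR_ge0 ?leey // lte_fin => H.
by exists z.
Qed.

Lemma acs_gamma_lt (y : option R[i]) (c : R) (z : R[i]) :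
  (acs_gamma y < c%:E)%E -> y = Some z -> expR (- c) < cabs z.
Proof.
move=> + yz; rewrite yz acs_gammaE lteNl.
rewrite -[(- c%:E)%E]/((- c)%:E) -[in (- c)%:E](expRK (- c)) -lne_EFin ?expR_gt0 //.
by rewrite lte_lne ?in_itv /= ?lee_fin ?cabs_ge0 ?expR_ge0 ?leey // lte_fin.
Qed.

Definition branch_factor (y : option R[i]) : {poly R[i]} :=
  if y is Some z then 'X - z%:P else 1.

(* |y1 - Y| / |y0 - Y| is bounded as long as |Y| stays away from |y0| = 1. *)
Lemma branch_factor_ratio (Yk : R -> option R[i]) (w : R) (y0 y1 : R[i]) :
  {for w, continuous (fun t => acs_gamma (Yk t))} -> acs_gamma (Yk w) <> 0%E ->
  cabs y0 = 1 ->
  exists C : R, 0 <= C /\ \forall t \near w,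
    cabs (branch_factor (Yk t)).[y1] <= C * cabs (branch_factor (Yk t)).[y0].
Proof.
move=> gc g0 y01.
(* By continuity the sign of gamma persists near w: either |Y| < rho < 1, or |Y| > rho > 1 with Y
   possibly infinite. The distance from [y0] to a finite Y is then at least |1 - rho|. *)
have [gpos|gneg|/esym //] := ltgtP 0%E (acs_gamma (Yk w)).
- have [c c0 cg] : exists2 c : R, 0 < c & (c%:E < acs_gamma (Yk w))%E.
    case: (acs_gamma (Yk w)) gpos => [g| |] //; rewrite ?lte_fin => g_gt0.
      by exists (g / 2); rewrite ?divr_gt0 // lte_fin; lra.
    by exists 1; rewrite ?ltry.
  have nearg : \forall t \near w, (c%:E < acs_gamma (Yk t))%E.
    exact: gc _ (open_ereal_gt' cg).
  set rho := expR (- c).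
  have rho1 : rho < 1 by rewrite expR_lt1 oppr_lt0.
  exists ((cabs y1 + 1) / (1 - rho)); split.
    by apply: divr_ge0; [exact: addr_ge0 (cabs_ge0 _) ler01 | rewrite subr_ge0; exact: ltW].
  apply: filterS nearg => t /acs_gamma_gt[z ->] zr.
  rewrite /branch_factor !hornerXsubC mulrAC ler_pdivlMr ?subr_gt0 //.
  rewrite ler_pM ?cabs_ge0 ?subr_ge0 ?(ltW rho1) //.
    rewrite (le_trans (cabsD _ _)) // cabsN lerD //.
    by rewrite (le_trans (ltW zr)) // ltW.
  have := cabsD (y0 - z) z; rewrite subrK y01 -/rho in zr *; lra.
- have [c c0 cg] : exists2 c : R, c < 0 & (acs_gamma (Yk w) < c%:E)%E.
    case: (acs_gamma (Yk w)) gneg => [g| |] //; rewrite ?lte_fin => g_gt0.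
      by exists (g / 2); rewrite ?lte_fin; lra.
    by exists (-1); rewrite ?ltNyr // oppr_lt0.
  have nearg : \forall t \near w, (acs_gamma (Yk t) < c%:E)%E.
    exact: gc _ (open_ereal_lt' cg).
  set rho := expR (- c).
  have rho1 : 1 < rho by rewrite expR_gt1 oppr_gt0.
  have C0 : 0 <= (cabs y1 + rho) / (rho - 1).
    have y1p := cabs_ge0 y1.
    by apply: divr_ge0; lra.
  (* The quotient bounds (|y1| + |z|) / (|z| - 1), which decreases in |z| > rho; the summand 1
     covers a root at infinity, whose factor is 1. *)
  exists (1 + (cabs y1 + rho) / (rho - 1)); split; first by rewrite addr_ge0.
  apply: filterS nearg => t; case E : (Yk t) => [z|] H; last first.
    by rewrite /branch_factor !hornerC cabs1 mulr1 lerDl.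
  have zr := acs_gamma_lt H erefl.
  rewrite /branch_factor !hornerXsubC.
  have H1 : cabs (y1 - z) <= cabs y1 + cabs z.
    by rewrite (le_trans (cabsD _ _)) // cabsN.
  have H2 : cabs z - 1 <= cabs (y0 - z).
    by have := cabsD (z - y0) y0; rewrite subrK y01 cabsB; lra.
  apply: (le_trans H1).
  apply: (@le_trans _ _ ((1 + (cabs y1 + rho) / (rho - 1)) * (cabs z - 1))); last first.
    by rewrite ler_wpM2l // addr_ge0.
  rewrite -(@ler_pM2l _ (rho - 1)) ?subr_gt0 //.
  have -> : (rho - 1) * ((1 + (cabs y1 + rho) / (rho - 1)) * (cabs z - 1))
     = ((rho - 1) + (cabs y1 + rho)) * (cabs z - 1).
    by field; rewrite subr_eq0 gt_eqF.
  have y1p := cabs_ge0 y1; move: zr; rewrite -/rho; move: (cabs y1) (cabs z) y1p => u v.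
  nra.
Qed.

End Branches.

(** * Polynomials and exponentials on the imaginary axis, and arguments modulo 2 pi *)

Section Imaginary.
Local Open Scope complex_scope.
Local Open Scope classical_set_scope.
Variable R : realType.

Lemma strictly_diff_im (p0 : R * R * R) :
  strictly_diff (fun p => 0 +i* p.2) p0 0 (0 +i* 1).
Proof.
apply: strictly_diff_eq (strictly_diffM (strictly_diff_cst (0 +i* 1) p0)
  (strictly_diff_snd p0)) _ _ _ => [p||]; first last.
- by rewrite mul0r add0r mulr1.
- by rewrite mul0r add0r mulr0.
- by apply/eqP; rewrite eq_complex /= !mul0r !mul1r subr0 add0r !eqxx.
Qed.

Lemma strictly_diff_cont_snd (f : R * R * R -> R[i]) u0 t0 a b :
  strictly_diff f (u0, t0) a b ->
  forall e, 0 < e -> \forall t \near t0, cabs (f (u0, t) - f (u0, t0)) <= e.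
Proof.
move=> fd e e0.
have c : (fun t => (u0, t)) @ t0 --> filter_prod (nbhs u0) (nbhs t0).
  by apply: (@cvg_pair _ _ _ (nbhs t0) (nbhs u0) (nbhs t0));
    [exact: cvg_cst | exact: cvg_id].
exact: c _ (strictly_diff_cont fd e0).
Qed.

Lemma horner2_im_cont (P : {poly {poly R[i]}}) (y : R[i]) (w e : R) : 0 < e ->
  \forall t \near w,
    cabs (P.[(0 +i* t)%:P].[y] - P.[(0 +i* w)%:P].[y]) <= e.
Proof.
move=> e0.
have H := strictly_diff_horner2 P (strictly_diff_im (0, w)) (strictly_diff_cst y (0, w)).
exact: (strictly_diff_cont_snd H e0).
Qed.

Lemma horner_im_neq0 (S : {poly R[i]}) (w : R) : S != 0 ->
  \forall t \near w, t != w -> S.[0 +i* t] != 0.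
Proof.
move=> S0; have [r [S1]] := multiplicity_XsubC S (0 +i* w).
rewrite S0 /= => S1w SE.
have c0 : 0 < cabs S1.[0 +i* w] / 2 by rewrite divr_gt0 // cabs_gt0.
have := strictly_diff_cont_snd (strictly_diff_horner S1 (strictly_diff_im (0, w))) c0.
apply: filterS => t /= H tw; rewrite SE hornerM mulf_neq0 //.
  apply/eqP => St; move: H; rewrite St sub0r cabsN.
  by move: c0; move: (cabs _) => c; lra.
rewrite horner_exp expf_neq0 // hornerXsubC subr_eq0.
by apply: contra tw => /eqP[->].
Qed.

Lemma near_neq_ex (w : R) (p : R -> Prop) :
  (\forall t \near w, p t) -> exists2 t, t != w & p t.
Proof.
move=> /nbhs_ballP[d /= d0 dP]; exists (w + d / 2).
  by rewrite -subr_eq0 addrAC subrr add0r gt_eqF // divr_gt0.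
apply: dP; rewrite -ball_normE /= opprD addrA subrr add0r normrN gtr0_norm ?divr_gt0 //.
by rewrite ltr_pdivrMr // ltr_pMr // ltr1n.
Qed.

Lemma cexp_im (x : R) : cexp (0 +i* x) = cos x +i* sin x.
Proof. by rewrite /cexp /= expR0 !mul1r. Qed.

Lemma cabs_cexp_im (x : R) : cabs (cexp (0 +i* x)) = 1.
Proof.
apply/eqP; rewrite -(@eqrXn2 _ 2) ?cabs_ge0 // cabs_sqr cexp_im /=.
by rewrite expr1n cos2Dsin2.
Qed.

Lemma delay_im (w t : R) : - ((0 +i* w) * t%:C) = 0 +i* - (w * t).
Proof. by apply/eqP; rewrite eq_complex /=; apply/andP; split; apply/eqP; ring. Qed.

Lemma carg_polar (y : R[i]) : cabs y = 1 ->
  y = cos (carg y) +i* sin (carg y) /\ - pi <= carg y <= pi.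
Proof.
move=> y1; have y2 : complex.Re y ^+ 2 + complex.Im y ^+ 2 = 1.
  by rewrite -cabs_sqr y1 expr1n.
have a1 : -1 <= complex.Re y <= 1.
  by rewrite -ler_norml -[1]y1 Re_le_cabs.
have sE : sin (acos (complex.Re y)) = `|complex.Im y|.
  rewrite sin_acos //; have -> : 1 - complex.Re y ^+ 2 = complex.Im y ^+ 2 by lra.
  exact: sqrtr_sqr.
have /andP[b0 bpi] : 0 <= acos (complex.Re y) <= pi by rewrite acos_ge0 ?acos_lepi.
have pi0 : 0 <= (pi : R) by exact: pi_ge0.
rewrite /carg y1 divr1; case: leP => iy; (split; last by lra).
- by rewrite acosK // sE ger0_norm //; case: (y).
- by rewrite cosN sinN acosK // sE ltr0_norm // opprK; case: (y).
Qed.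

Lemma cos_sinD2pin (x : R) (k : nat) :
  cos (x + 2 * pi * k%:R) = cos x /\ sin (x + 2 * pi * k%:R) = sin x.
Proof.
elim: k => [|k [IH1 IH2]]; first by rewrite mulr0 addr0.
have -> : x + 2 * pi * k.+1%:R = (x + 2 * pi * k%:R) + pi *+ 2.
  by rewrite -natr1 -mulr_natl; ring.
by rewrite cosD [sin (_ + pi *+ 2)]sinD cos2pi sin2pi IH1 IH2; split; ring.
Qed.

(** If cos u = 1 then sin(u / 2) = 0, which is impossible for u in (0, 2 pi). The lower bound on x
    excludes the negative multiples of 2 pi. *)
Lemma cos_eq1_nat (x : R) : cos x = 1 -> - pi < x ->
  exists k : nat, x = 2 * pi * k%:R.
Proof.
move=> cx xpi; have pi0 : 0 < (pi : R) by exact: pi_gt0.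
have half (u : R) : cos u = 1 -> sin (u / 2) = 0.
  move=> cu; have : cos (u / 2 + u / 2) = 1 by rewrite -splitr.
  rewrite cosD -!expr2 => H; have := cos2Dsin2 (u / 2) => H2.
  by apply/eqP; rewrite -sqrf_eq0; apply/eqP; lra.
have [x0|x0] := leP 0 x; last first.
  have : 0 < sin (- (x / 2)) by apply: sin_gt0_pi; lra.
  by rewrite sinN half // oppr0 ltxx.
(* The remainder u = x - 2 pi k lies in [0, 2 pi) and still has cosine 1, so it vanishes. *)
pose k := Num.truncn (x / (2 * pi)).
exists k.
have xp : 0 <= x / (2 * pi) by rewrite divr_ge0 // mulr_ge0 // ltW.
have /andP[k1 k2] := truncn_itv xp.
have p2 : 0 < 2 * (pi : R) by rewrite mulr_gt0.
move: k1 k2; rewrite -/k ler_pdivlMr // ltr_pdivrMr // -natr1 => k1 k2.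
pose u := x - 2 * pi * k%:R.
have cu : cos u = 1 by rewrite -(cos_sinD2pin u k).1 /u subrK.
have [u0|u0|] := ltgtP 0 u; last by rewrite /u => /esym/eqP; rewrite subr_eq0 => /eqP.
  have : 0 < sin (u / 2) by apply: sin_gt0_pi; move: u0; rewrite /u; lra.
  by rewrite half // ltxx.
by move: u0; rewrite /u; lra.
Qed.

End Imaginary.

(** * Crossings occur only at the listed delays *)

Section Crossings.
Local Open Scope complex_scope.
Local Open Scope classical_set_scope.
Variables (R : realType) (n : nat) (A B : 'M[R]_n).
Variables (m : nat) (Y : 'I_m -> R -> option R[i]).
Hypothesis hY : acs_branches A B Y.

Local Notation P := (char_poly2 A B).

Lemma genpoly_prod omega : ~ degenerate A B omega ->
  genpoly A B omega = lead_coef (genpoly A B omega) *: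
    \prod_(k < m) branch_factor (Y k omega).
Proof. by case: hY => _ H _ /H. Qed.

Lemma genpoly_root omega y : ~ degenerate A B omega ->
  (genpoly A B omega).[y] = 0 -> exists k, Y k omega = Some y.
Proof.
move=> nd; rewrite genpoly_prod // hornerZ => /eqP; rewrite mulf_eq0 lead_coef_eq0.
have /nondegenerateP sz := nd.
rewrite -size_poly_eq0; case: eqP => [E|_]; first by rewrite E in sz.
rewrite horner_prod => /prodf_eq0[k _].
case E : (Y k omega) => [z|] /=; last by rewrite hornerC oner_eq0.
by rewrite hornerXsubC subr_eq0 => /eqP ->; exists k.
Qed.

Lemma char_poly2_neq0 : P != 0.
Proof.
case: hY => -[w1 w1P] _ _; apply/eqP => P0.
by move: w1P; rewrite genpolyE P0 horner0 size_poly0.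
Qed.

(** The coefficient of Y^m in P(l, Y) is a nonzero polynomial in l, so its zeros on the imaginary
    axis are isolated; where it is nonzero the degree in Y is at least m > 0. *)
Lemma near_nondegenerate omega : (0 < m)%N ->
  \forall t \near omega, t != omega -> ~ degenerate A B t.
Proof.
move=> m0; case: hY => -[w1 w1P] _ _.
have S0 : map_poly (coefp m) P != 0.
  apply/eqP => S0; have : (genpoly A B w1)`_m = 0.
    by rewrite genpolyE coef_horner_polyC S0 horner0.
  move/eqP; have -> : m = (size (genpoly A B w1)).-1 by rewrite w1P.
  by rewrite -lead_coefE lead_coef_eq0 -size_poly_eq0 w1P.
have := horner_im_neq0 omega S0; apply: filterS => t H /H.
rewrite -coef_horner_polyC -genpolyE => cm; apply/nondegenerateP.
rewrite ltnNge; apply: contra cm => sz; apply/eqP.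
by apply: nth_default; rewrite (leq_trans sz).
Qed.

(* If no gamma_k vanished at omega, the product formula would bound
   |Q(i t, y1)| by a multiple of |Q(i t, y0)| for t near omega, hence
   Q(i omega, .) would vanish identically. *)
Lemma branch_at_unimodular_root (Q : {poly {poly R[i]}}) r omega y0 : (0 < m)%N ->
  P = Q * ('X - (0 +i* omega)%:P%:P) ^+ r -> Q.[(0 +i* omega)%:P] != 0 ->
  cabs y0 = 1 -> Q.[(0 +i* omega)%:P].[y0] = 0 ->
  exists k, acs_gamma (Y k omega) = 0%E.
Proof.
move=> m0 PE Q0 y01 Qy0; apply: contrapT => noY.
have {}noY k : acs_gamma (Y k omega) <> 0%E by move=> E; apply: noY; exists k.
have /closed_nonrootP[y1] := Q0; rewrite /root => Qy1.
have Yc k : {for omega, continuous (fun t => acs_gamma (Y k t))} by case: hY => _ _; apply.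
have /choice[C CP] := fun k => branch_factor_ratio y1 (Yc k) (noY k) y01.
pose K := \prod_(k < m) C k.
have K0 : 0 <= K by apply: prodr_ge0 => k _; case: (CP k).
pose d := cabs Q.[(0 +i* omega)%:P].[y1].
have d0 : 0 < d by rewrite cabs_gt0.
(* Near omega, |Q(i t, y1)| >= 2d/3, while the product bound gives at most K d / (3 (K + 1)) <=
   d/3. *)
have d30 : 0 < d / 3 by rewrite divr_gt0.
have dK0 : 0 < d / (3 * (K + 1)) by rewrite divr_gt0 // mulr_gt0 // ltr_wpDl.
have PQ t y : P.[(0 +i* t)%:P].[y] =
    Q.[(0 +i* t)%:P].[y] * (0 +i* t - 0 +i* omega) ^+ r.
  by rewrite PE hornerM hornerM horner_exp hornerXsubC -rmorphB -rmorphXn hornerC.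
have Cn : \forall t \near omega, forall k, cabs (branch_factor (Y k t)).[y1]
    <= C k * cabs (branch_factor (Y k t)).[y0].
  by apply: (@filter_forall _ _ _ (nbhs omega) _) => k; case: (CP k).
have nd := near_nondegenerate omega m0.
have c1 := horner2_im_cont Q y1 omega d30.
have c0 := horner2_im_cont Q y0 omega dK0.
(* Away from omega the product formula holds for P and the factor (i t - i omega)^r is nonzero, so
   the bound passes from P to Q. *)
have [t tw [[/(_ tw) ndt Ct] [H1 H0]]] :=
  near_neq_ex (filterI (filterI nd Cn) (filterI c1 c0)).
move: H0; rewrite Qy0 subr0 => H0.
have HP : cabs P.[(0 +i* t)%:P].[y1] <= K * cabs P.[(0 +i* t)%:P].[y0].
  rewrite -!genpolyE genpoly_prod // !hornerZ !cabsM mulrCA ler_wpM2l ?cabs_ge0 //.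
  rewrite !horner_prod !cabs_prod -big_split /=.
  by apply: ler_prod => k _; rewrite cabs_ge0 Ct.
have it0 : 0 < cabs ((0 +i* t - 0 +i* omega) ^+ r).
  rewrite cabs_gt0 expf_neq0 // subr_eq0.
  by apply: contra tw => /eqP[->].
have HQ : cabs Q.[(0 +i* t)%:P].[y1] <= K * cabs Q.[(0 +i* t)%:P].[y0].
  by move: HP; rewrite !PQ !cabsM mulrA ler_pM2r.
have H2 : d <= cabs Q.[(0 +i* t)%:P].[y1] + d / 3.
  rewrite /d -{1}[Q.[_].[y1]](subrK Q.[(0 +i* t)%:P].[y1]) addrC.
  apply: (le_trans (cabsD _ _)); rewrite lerD // cabsB //.
have H3 : K * cabs Q.[(0 +i* t)%:P].[y0] <= K * (d / (3 * (K + 1))).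
  by rewrite ler_wpM2l.
have H4 : K * (d / (3 * (K + 1))) <= d / 3.
  rewrite mulrA ler_pdivrMr ?mulr_gt0 ?ltr_wpDl //.
  have -> : d / 3 * (3 * (K + 1)) = K * d + d by field.
  by rewrite lerDl ltW.
have := le_trans HQ (le_trans H3 H4); move: H2 d0.
move: (cabs Q.[(0 +i* t)%:P].[y1]) => v; lra.
Qed.

Lemma crossing_branch tauH omega : (0 < m)%N -> transverse_crossing A B tauH omega ->
  exists k, acs_gamma (Y k omega) = 0%E.
Proof.
move=> m0 [d d0 [al [mu [near_root al0 mu0 ald]]]].
have [r [Q]] := multiplicity_XsubC P (0 +i* omega)%:P.
rewrite char_poly2_neq0 /= => Q0 PE.
pose y0 := cexp (0 +i* - (omega * tauH)).
apply: (branch_at_unimodular_root m0 PE (y0 := y0)) => //.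
  exact: cabs_cexp_im.
(* If Q did not vanish at the contact point it would be nonzero along the whole nearby root curve;
   but Q vanishes wherever that curve is off the imaginary axis. *)
apply/eqP; apply: contrapT => /negP v0.
pose p0 : R * R * R := ((0, omega), tauH).
pose F (p : R * R * R) := Q.[(cpt p.1)%:P].[cexp (-1 * (cpt p.1 * p.2%:C))].
have Fd := strictly_diff_horner2 Q (strictly_diff_fst p0)
  (strictly_diff_cexp (strictly_diffM (strictly_diff_cst (-1) p0)
    (strictly_diffM (strictly_diff_fst p0) (strictly_diff_snd p0)))).
have F0 : F p0 = Q.[(0 +i* omega)%:P].[y0] by rewrite /F /p0 /= /cpt /= mulN1r delay_im.
have Fv0 : 0 < cabs (F p0) / 2 by rewrite divr_gt0 // cabs_gt0 F0.
have Fc := strictly_diff_cont Fd Fv0.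
have [_ _ alc muc] := nbhs_singleton near_root.
have c : (fun t => ((al t, mu t), t)) @ tauH --> filter_prod (nbhs (0, omega)) (nbhs tauH).
  apply: (@cvg_pair _ _ _ (nbhs tauH) (nbhs (0, omega)) (nbhs tauH)); last exact: cvg_id.
  apply: (@cvg_pair _ _ _ (nbhs tauH) (nbhs 0) (nbhs omega)).
    by rewrite -al0; exact: alc.
  by rewrite -mu0; exact: muc.
have near_F : \forall t \near tauH,
    cabs (F ((al t, mu t), t) - F p0) <= cabs (F p0) / 2 := c _ Fc.
(* With error |d|/2 per unit of time, alpha(t) = 0 would give |d| |t - tauH| <= |d|/2 |t - tauH|,
   hence t = tauH. *)
have d20 : 0 < `|d| / 2 by rewrite divr_gt0 // normr_gt0.
have near_d := (is_derive_nearP al tauH d).1 ald _ d20.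
have [t tt [[H1 _ _ _] [H2 H3]]] := near_neq_ex (filterI near_root (filterI near_F near_d)).
have alt0 : al t != 0.
  apply: contraNneq tt => alt0; move: H3; rewrite al0 alt0 subrr sub0r normrN normrM.
  have -> : `|d| * `|t - tauH| = (`|d| / 2 * `|t - tauH|) * 2 by field.
  rewrite -subr_eq0 -normr_eq0.
  have : 0 <= `|d| / 2 * `|t - tauH| by rewrite mulr_ge0 // ltW.
  move=> Hp Hle; have /eqP : `|d| / 2 * `|t - tauH| = 0 by lra.
  by rewrite mulf_eq0 gt_eqF.
move: H1; rewrite /char_root char_funE PE hornerM hornerM horner_exp hornerXsubC.
rewrite -rmorphB -rmorphXn hornerC => /eqP; rewrite mulf_eq0 expf_eq0 subr_eq0.
have -> : (al t +i* mu t == 0 +i* omega) = false.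
  by rewrite eq_complex /= (negbTE alt0).
rewrite andbF orbF => /eqP FE.
have Ft : F ((al t, mu t), t) = 0 by rewrite /F mulN1r.
move: H2; rewrite Ft sub0r cabsN.
by move: Fv0; move: (cabs (F p0)) => v; lra.
Qed.

Variables (j : 'I_m) (omegaH : R).
Hypothesis hI : universality_class_I A B Y j omegaH.

Lemma class_I_zero k omega : acs_gamma (Y k omega) = 0%E -> k = j /\ `|omega| = omegaH.
Proof.
case: hI => w0 _ pos neg oth E.
have [kj|/eqP kj] := eqVneq k j; last by case: (oth k omega (introN eqP kj)).
split=> //; rewrite kj in E.
have [H|H] := boolP (- omegaH <= omega <= omegaH); last first.
  by have := neg _ H; rewrite E ltxx.
have [H'|] := boolP (- omegaH < omega < omegaH).
  by have := pos _ H'; rewrite E ltxx.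
move: H => /andP[H1 H2]; rewrite negb_and -!leNgt => /orP[H3|H3].
  by have -> : omega = - omegaH; [lra | rewrite normrN gtr0_norm].
by have -> : omega = omegaH; [lra | rewrite gtr0_norm].
Qed.

Lemma class_I_nondegenerate omega : `|omega| = omegaH -> ~ degenerate A B omega.
Proof.
case: hI => w0 [nd1 nd2 _ _] _ _ _.
by case: (ger0P omega) => _ wH; [rewrite wH | rewrite -[omega]opprK wH].
Qed.

Lemma class_I_root omega y : `|omega| = omegaH -> cabs y = 1 ->
  P.[(0 +i* omega)%:P].[y] = 0 -> Y j omega = Some y.
Proof.
move=> wH y1; rewrite -genpolyE => /(genpoly_root (class_I_nondegenerate wH))[k Yk].
have : acs_gamma (Y k omega) = 0%E by rewrite Yk; apply/acs_gamma_eq0.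
by case/class_I_zero => <- _.
Qed.

Lemma crossing_delay_of_root tauH : 0 < tauH ->
  P.[(0 +i* omegaH)%:P].[cexp (0 +i* - (omegaH * tauH))] = 0 ->
  exists k : nat, tauH = crossing_delay (Y j) omegaH k.
Proof.
case: hI => w0 _ _ _ _ tau0 H.
have YH : Y j omegaH = Some (cexp (0 +i* - (omegaH * tauH))).
  by apply: class_I_root => //; [rewrite gtr0_norm | exact: cabs_cexp_im].
rewrite /crossing_delay /crossing_phase YH.
have [] := carg_polar (cabs_cexp_im (- (omegaH * tauH))).
set phi := carg _ => + /andP[phi1 phi2].
rewrite cexp_im cosN sinN => -[cE sE].
have wt : 0 < omegaH * tauH by rewrite mulr_gt0.
(* Since Y_j(omegaH) = exp(- i omegaH tauH), this sum is a multiple of 2 pi. It exceeds - pi because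
   tauH > 0 and phi >= - pi, which makes k nonnegative. *)
have [||k kE] := @cos_eq1_nat R (omegaH * tauH + phi).
- rewrite cosD cE; have -> : sin (omegaH * tauH) = - sin phi by lra.
  by rewrite mulNr opprK -!expr2 cos2Dsin2.
- lra.
exists k; rewrite -kE.
have -> : - phi + (omegaH * tauH + phi) = omegaH * tauH by ring.
by rewrite mulKf // gt_eqF.
Qed.

Lemma crossing_only_at_delays tauH omega : 0 < tauH ->
  transverse_crossing A B tauH omega ->
  `|omega| = omegaH /\ exists k : nat, tauH = crossing_delay (Y j) omegaH k.
Proof.
move=> tau0 tc; have m0 : (0 < m)%N by case: (j) => i /= /(leq_ltn_trans (leq0n i)).
have [k /class_I_zero[_ wH]] := crossing_branch m0 tc.
split=> //; apply: crossing_delay_of_root => //.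
case: tc => d d0 [al [mu [/nbhs_singleton [H _ _ _] al0 mu0 _]]].
move: H; rewrite al0 mu0 /char_root char_funE delay_im => H.
(* A crossing at omega = - omegaH is turned into a root at i omegaH by conjugation. *)
move: wH; have [w0 <- //|w0 <-] := ger0P omega.
have E1 : 0 +i* - omega = (0 +i* omega)^*%C by [].
have E2 : cexp (0 +i* - (- omega * tauH)) = (cexp (0 +i* - (omega * tauH)))^*%C.
  by rewrite !cexp_im mulNr !cosN sinN /= !sinN opprK.
by rewrite E1 E2 char_poly2_conj H conjc0.
Qed.

End Crossings.

(** * The crossings at the listed delays are destabilizing *)

Section Destabilizing.
Local Open Scope complex_scope.
Local Open Scope classical_set_scope.
Variables (R : realType) (n : nat) (A B : 'M[R]_n).
Variables (m : nat) (Y : 'I_m -> R -> option R[i]) (j : 'I_m) (omegaH : R).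
Hypothesis hY : acs_branches A B Y.
Hypothesis hI : universality_class_I A B Y j omegaH.

Local Notation P := (char_poly2 A B).

(** At an infinite root [acs_gamma] is -oo, so its vanishing forces a finite value. *)
Lemma class_I_critical_value : exists2 yH, Y j omegaH = Some yH & cabs yH = 1.
Proof.
case: hI => _ [_ _ + _] _ _ _; case: (Y j omegaH) => [y|] //.
by move=> /acs_gamma_eq0; exists y.
Qed.

Variable yH : R[i].
Hypotheses (YH : Y j omegaH = Some yH) (yH1 : cabs yH = 1).

Local Notation lH := (0 +i* omegaH).
Local Notation PY := (P.[lH%:P]^`().[yH]).
Local Notation Pl := (P^`().[lH%:P].[yH]).

Lemma nondegenerate_omegaH : ~ degenerate A B omegaH.
Proof. by case: hI => _ []. Qed.

Lemma critical_root : P.[lH%:P].[yH] = 0.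
Proof.
rewrite -genpolyE (genpoly_prod hY nondegenerate_omegaH) hornerZ horner_prod.
by rewrite (bigD1 j) //= YH /= hornerXsubC subrr mul0r mulr0.
Qed.

(** The derivative at [yH] is the leading coefficient times the product of the factors k != j. None
    of these vanishes, since a root equal to [yH] would make gamma_k zero. *)
Lemma critical_root_simple : PY != 0.
Proof.
rewrite -genpolyE (genpoly_prod hY nondegenerate_omegaH) derivZ hornerZ.
rewrite mulf_neq0 //.
  have /nondegenerateP sz := nondegenerate_omegaH.
  by rewrite lead_coef_eq0 -size_poly_eq0 -lt0n (ltn_trans _ sz).
rewrite (bigD1 j) //= YH /= derivM derivXsubC hornerD !hornerM hornerXsubC.
rewrite subrr mul0r addr0 hornerC mul1r horner_prod.
apply/prodf_neq0 => k kj; case E : (Y k omegaH) => [z|] /=; last first.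
  by rewrite hornerC oner_neq0.
rewrite hornerXsubC subr_eq0; apply/eqP => zy.
case: hI => _ _ _ _ oth; apply: (oth k omegaH kj).
by rewrite E; apply/acs_gamma_eq0; rewrite -zy.
Qed.

Let q := Pl / (yH * PY).

Lemma critical_value_neq0 : yH != 0.
Proof. by rewrite -cabs_eq0 yH1 oner_neq0. Qed.

(* The implicit function theorem gives a root y(omega) of the generating
   polynomial near yH; the other branches stay away from it, so that it is
   Y_j(omega). *)
Lemma branch_near : exists eta : R -> R * R,
  [/\ cpt (eta omegaH) = yH,
      \forall t \near omegaH, Y j t = Some (cpt (eta t)) &
      forall e : R, 0 < e -> \forall t \near omegaH,
        cabs (cpt (eta t) - yH - (- 'i%C * q * yH) * (t - omegaH)%:C)
          <= e * `|t - omegaH|].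
Proof.
pose p0 : R * R * R := (cpt_of yH, omegaH).
have Fd := strictly_diff_horner2 P (strictly_diff_im p0) (strictly_diff_fst p0).
have [||eta [eta0 etaP etac etad]] := implicit_function Fd.
- by rewrite /= cpt_ofK critical_root.
- by rewrite /= cpt_ofK mulr0 add0r mulr1 critical_root_simple.
exists eta; rewrite eta0 cpt_ofK; split=> //; last first.
  move=> e /etad; apply: filterS => t; rewrite /= cpt_ofK.
  set u := - (_ / _); suff -> : u = - 'i%C * q * yH by [].
  rewrite /u /q mulr0 addr0 mulr0 add0r mulr1.
  have := critical_value_neq0; have := critical_root_simple.
  have -> : (0 +i* 1) = 'i%C :> R[i] by [].
  by move: PY Pl => a b a0 y0; field; rewrite a0 y0.
have m0 : (0 < m)%N by case: (j) => i /= /(leq_ltn_trans (leq0n i)).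
have nd : \forall t \near omegaH, ~ degenerate A B t.
  apply: filterS (near_nondegenerate hY omegaH m0) => t H.
  by have [->|/H//] := eqVneq t omegaH; exact: nondegenerate_omegaH.
have etay (e : R) : 0 < e -> \forall t \near omegaH, cabs (yH - cpt (eta t)) <= e.
  move=> e0; have e20 : 0 < e / 2 by rewrite divr_gt0.
  have /cvgrPdist_le/(_ _ e20) := nbhs_singleton etac.
  apply: filterS => t; rewrite eta0 => H.
  rewrite -[yH]cpt_ofK -cptB (le_trans (cabs_cpt_le _)) //; lra.
have other k : k != j -> \forall t \near omegaH, Y k t <> Some (cpt (eta t)).
  move=> kj.
  have kc : {for omegaH, continuous (fun t => acs_gamma (Y k t))}.
    by case: hY => _ _; apply.
  have k0 : acs_gamma (Y k omegaH) <> 0%E by case: hI => _ _ _ _; apply.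
  (* Were Y_k(t) = eta(t) -> yH, its distance to [yH + 1] would tend to 1 while being at most C
     times its distance to [yH], which tends to 0. *)
  have [C [C0 nC]] := branch_factor_ratio (yH + 1) kc k0 yH1.
  have e0 : 0 < 1 / (2 * (C + 1)) by rewrite divr_gt0 // mulr_gt0 // ltr_wpDl.
  apply: filterS2 nC (etay _ e0) => t + H E.
  rewrite E /branch_factor !hornerXsubC => H1.
  have H2 : 1 <= cabs (yH + 1 - cpt (eta t)) + cabs (yH - cpt (eta t)).
    have E1 : cabs (yH + 1 - cpt (eta t) - (yH - cpt (eta t))) = 1.
      by rewrite (_ : _ - _ = 1) ?cabs1 //; ring.
    by rewrite -[leLHS]E1 (le_trans (cabsD _ _)) // cabsN.
  have : (C + 1) * cabs (yH - cpt (eta t)) <= (C + 1) * (1 / (2 * (C + 1))).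
    by rewrite ler_wpM2l // addr_ge0.
  have -> : (C + 1) * (1 / (2 * (C + 1))) = 1 / 2.
    by field; rewrite gt_eqF // ltr_wpDl.
  move: H1 H2; rewrite mulrDl mul1r.
  move: (cabs (yH + 1 - _)) (cabs (yH - _)) => u v; lra.
have {}other : \forall t \near omegaH, forall k, k != j -> Y k t <> Some (cpt (eta t)).
  apply: (@filter_forall _ _ _ (nbhs omegaH) _) => k.
  have [->|kj] := eqVneq k j; first by apply: nearW.
  by apply: filterS (other k kj) => t H _.
apply: filterS2 (filterI nd etaP) other => t [ndt /= Pt] oth.
have [|k Yk] := genpoly_root hY ndt (y := cpt (eta t)); first by rewrite genpolyE.
by have [<- //|/oth] := eqVneq k j; rewrite Yk.
Qed.

(** Near omegaH, gamma_j = - 1/2 ln |eta|^2, and eta' = - i q eta at omegaH. The logarithmic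
    derivative of |eta| is therefore Re(- i q) = Im q. *)
Lemma gamma_derive :
  is_derive omegaH 1 (fun t => fine (acs_gamma (Y j t))) (- complex.Im q).
Proof.
have [eta [eta0 etaY etad]] := branch_near.
have etad' e : 0 < e -> \forall t \near omegaH,
    `|(eta t).1 - (eta omegaH).1 - complex.Re (- 'i%C * q * yH) * (t - omegaH)|
      <= e * `|t - omegaH| /\
    `|(eta t).2 - (eta omegaH).2 - complex.Im (- 'i%C * q * yH) * (t - omegaH)|
      <= e * `|t - omegaH|.
  move=> e0; apply: filterS (etad e e0) => t; rewrite -eta0.
  set z := cpt (eta t) - _ - _ => H.
  split; apply: le_trans H.
    suff -> : (eta t).1 - (eta omegaH).1 -
      complex.Re (- 'i%C * q * cpt (eta omegaH)) * (t - omegaH)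
      = complex.Re z by exact: Re_le_cabs.
    by rewrite /z; move: (- 'i%C * q * _) => -[u v] /=; ring.
  suff -> : (eta t).2 - (eta omegaH).2 -
      complex.Im (- 'i%C * q * cpt (eta omegaH)) * (t - omegaH)
      = complex.Im z by exact: Im_le_cabs.
  by rewrite /z; move: (- 'i%C * q * _) => -[u v] /=; ring.
have d1 : is_derive omegaH 1 (fun t => (eta t).1) (complex.Re (- 'i%C * q * yH)).
  by apply/is_derive_nearP => e /etad'; apply: filterS => t [].
have d2 : is_derive omegaH 1 (fun t => (eta t).2) (complex.Im (- 'i%C * q * yH)).
  by apply/is_derive_nearP => e /etad'; apply: filterS => t [].
have n1 : (eta omegaH).1 ^+ 2 + (eta omegaH).2 ^+ 2 = 1.
  by rewrite -(cabs_sqr (cpt (eta omegaH))) eta0 yH1 expr1n.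
pose N t := (eta t).1 ^+ 2 + (eta t).2 ^+ 2.
have dN : is_derive omegaH 1 N (2 * (complex.Re yH * complex.Re (- 'i%C * q * yH)
    + complex.Im yH * complex.Im (- 'i%C * q * yH))).
  rewrite -eta0; apply: is_derive_eq.
  by rewrite /GRing.scale /= eta0; ring.
have dln : is_derive (N omegaH) 1 (@ln R) (N omegaH)^-1.
  by apply: is_derive1_ln; rewrite /N n1.
have dG : is_derive omegaH 1 (fun t => - (1 / 2) * ln (N t)) (- complex.Im q).
  apply: (is_derive_eq (is_deriveZ (- (1 / 2)) (is_derive1_comp dln dN))).
  rewrite /GRing.scale /= /N n1 invr1 mul1r.
  have := cabs_sqr yH; rewrite yH1 expr1n.
  move: (yH) (q) => -[a b] [u v] /= H.
  transitivity (- (v * (a ^+ 2 + b ^+ 2))); last by rewrite -H mulr1.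
  by field.
have YG t : Y j t = Some (cpt (eta t)) ->
    fine (acs_gamma (Y j t)) = - (1 / 2) * ln (N t).
  move=> ->; rewrite acs_gammaE /N -(cabs_sqr (cpt (eta t))).
  have [c0|c0] := ltP 0 (cabs (cpt (eta t))).
    by rewrite lne_EFin //= lnXn // mulr2n; field.
  (* At eta = 0 both sides are 0 by default values: [fine +oo] is 0 and so is [ln 0]. *)
  have -> : cabs (cpt (eta t)) = 0 by apply/eqP; rewrite eq_le c0 cabs_ge0.
  by rewrite le0_lneNy ?lexx //= expr0n /= ln0 // mulr0.
apply/is_derive_nearP => e e0.
have YH' := nbhs_singleton etaY.
apply: filterS2 ((is_derive_nearP _ _ _).1 dG _ e0) etaY => t H Yt.
by rewrite !YG.
Qed.

(** A positive slope at the zero omegaH would make gamma_j negative just to the left, where class I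
    makes it positive. *)
Lemma gamma_derive_le0 : - complex.Im q <= 0.
Proof.
pose D := - complex.Im q; rewrite leNgt -/D; apply/negP => D0.
have D20 : 0 < D / 2 by rewrite divr_gt0.
case: hI => w0 [_ _ g0 _] pos _ _.
have /nbhs_ballP[d /= d0 dP] := (is_derive_nearP _ _ _).1 gamma_derive _ D20.
pose s := Num.min (d / 2) omegaH.
have s0 : 0 < s by rewrite lt_min w0 divr_gt0.
have sd : s <= d / 2 by rewrite ge_min lexx.
have sw : s <= omegaH by rewrite ge_min lexx orbT.
have sB : ball omegaH d (omegaH - s).
  rewrite -ball_normE /= opprB addrCA subrr addr0 gtr0_norm //; lra.
have := dP _ sB; rewrite -/D g0 /= subr0.
have -> : omegaH - s - omegaH = - s by ring.
rewrite normrN (gtr0_norm s0) => H.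
have : (0 < acs_gamma (Y j (omegaH - s)))%E by apply: pos; lra.
(* Only nonnegativity survives [fine], which sends +oo to 0; it suffices, as the slope gives a value
   at most - D s / 2. *)
move=> /ltW /fine_ge0; move: H; rewrite ler_norml => /andP[_].
have : 0 < D * s by rewrite mulr_gt0.
move: (fine _) => v; lra.
Qed.

Hypothesis transverse : transverse_branch (Y j) omegaH.

(** Class I gives the weak inequality; the nonzero slope of the branch makes it strict. *)
Lemma Im_q_gt0 : 0 < complex.Im q.
Proof.
have := transverse; rewrite /transverse_branch derive1E.
rewrite (derive_val (is_derive := gamma_derive)) => D0.
rewrite -oppr_lt0 lt_neqAle D0; exact: gamma_derive_le0.
Qed.

Lemma cexp_crossing_delay k :
  cexp (- (lH * (crossing_delay (Y j) omegaH k)%:C)) = yH.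
Proof.
have w0 : omegaH != 0 by case: hI => w0 *; rewrite gt_eqF.
rewrite delay_im /crossing_delay /crossing_phase YH mulrA mulfV // mul1r.
rewrite cexp_im cosN sinN (cos_sinD2pin _ _).1 (cos_sinD2pin _ _).2 cosN sinN opprK.
by have [<- _] := carg_polar yH1.
Qed.

Lemma destabilizing_at_delay k :
  destabilizing_crossing A B (crossing_delay (Y j) omegaH k) omegaH.
Proof.
set tau := crossing_delay _ _ _.
have w0 : 0 < omegaH by case: hI.
have E := cexp_crossing_delay k; rewrite -/tau in E.
pose p0 : R * R * R := ((0, omegaH), tau).
have Fd := strictly_diff_horner2 P (strictly_diff_fst p0)
  (strictly_diff_cexp (strictly_diffM (strictly_diff_cst (-1) p0)
    (strictly_diffM (strictly_diff_fst p0) (strictly_diff_snd p0)))).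
move: Fd; rewrite /= !mulN1r.
have -> : cpt (0, omegaH) = lH by [].
rewrite E !mul0r !add0r !mul1r !mulr1 !mulr0 !addr0 !add0r => Fd.
have qE : Pl = q * (yH * PY).
  by rewrite /q divfK // mulf_neq0 ?critical_value_neq0 ?critical_root_simple.
(* As tau is real, Im(q - tau) = Im q > 0. Hence the derivative in l of P(l, exp(- l tau)), equal to
   yH PY (q - tau), is nonzero and the implicit function theorem applies. *)
have qt0 : q - tau%:C != 0.
  apply/eqP => qt; have := Im_q_gt0.
  by have -> : complex.Im q = complex.Im (q - tau%:C);
    [case: (q) => u v /=; ring | rewrite qt ltxx].
set a1 := Pl + _ in Fd; set b1 := PY * _ in Fd.
have a1E : a1 = yH * PY * (q - tau%:C) by rewrite /a1 qE; ring.
have a10 : a1 != 0 by rewrite a1E !mulf_neq0 ?critical_value_neq0 ?critical_root_simple.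
have slopeE : - (b1 / a1) = lH / (q - tau%:C).
  rewrite a1E /b1; have := critical_value_neq0; have := critical_root_simple; move: qt0.
  by move: PY (q - tau%:C) => c x x0 c0 y0; field; rewrite x0 y0 c0.
have [|//|zeta [zeta0 zetaP zetac zetad]] := implicit_function Fd.
  by rewrite /= mulN1r -[cpt _]/lH E critical_root.
(* The crossing speed is Re(i omegaH / (q - tau)) = omegaH Im q / |q - tau|^2. *)
exists (complex.Re (- (b1 / a1))).
  rewrite slopeE; have := Im_q_gt0; have := qt0.
  move: (q) => -[u v] /= uv0 v0.
  rewrite mul0r sub0r mulrN opprK mulr_gt0 // divr_gt0 //; first by rewrite oppr0 addr0.
  by rewrite oppr0 addr0 ltr_wpDl ?sqr_ge0 // exprn_gt0.
exists (fun t => (zeta t).1), (fun t => (zeta t).2); split; rewrite ?zeta0 //.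
  apply: filterS2 zetaP zetac => t H zc.
  have rt : char_root A B t ((zeta t).1 +i* (zeta t).2).
    by rewrite /char_root char_funE -[RHS]H mulN1r.
  split; first exact: rt.
  - have -> : (zeta t).1 -i* (zeta t).2 = ((zeta t).1 +i* (zeta t).2)^*%C by [].
    rewrite /char_root char_funE.
    have -> : cexp (- (((zeta t).1 +i* (zeta t).2)^*%C * t%:C)) =
      (cexp (- (((zeta t).1 +i* (zeta t).2) * t%:C)))^*%C.
      apply/eqP; rewrite eq_complex /cexp /= !mulr0 !subr0 !add0r !mulNr !opprK.
      by rewrite !cosN !sinN mulrN opprK !eqxx.
    by rewrite char_poly2_conj -char_funE rt conjc0.
  - apply: (@cvg_comp _ _ _ zeta fst (nbhs t) (nbhs (zeta t)) (nbhs (zeta t).1) zc).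
    exact: (@cvg_fst _ _ (nbhs (zeta t).1) (nbhs (zeta t).2) _).
  - apply: (@cvg_comp _ _ _ zeta snd (nbhs t) (nbhs (zeta t)) (nbhs (zeta t).2) zc).
    exact: (@cvg_snd _ _ (nbhs (zeta t).1) (nbhs (zeta t).2) _).
apply/is_derive_nearP => e e0; apply: filterS (zetad e e0) => t.
set z := cpt (zeta t) - _ - _ => H; apply: le_trans H.
suff -> : (zeta t).1 - (zeta tau).1 - complex.Re (- (b1 / a1)) * (t - tau) = complex.Re z.
  exact: Re_le_cabs.
by rewrite /z zeta0; move: (- (b1 / a1)) => -[u v] /=; ring.
Qed.

End Destabilizing.

Theorem corollary4p1 (R : realType) (n : nat) (A B : 'M[R]_n)
    (m : nat) (Y : 'I_m -> R -> option R[i]) (j : 'I_m) (omegaH : R)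
    (hY : acs_branches A B Y)
    (hI : universality_class_I A B Y j omegaH) :
  (transverse_branch (Y j) omegaH ->
     forall k : nat,
       destabilizing_crossing A B (crossing_delay (Y j) omegaH k) omegaH)
  /\
  (forall tauH omega : R, 0 < tauH -> transverse_crossing A B tauH omega ->
     `|omega| = omegaH /\
     exists k : nat, tauH = crossing_delay (Y j) omegaH k).
Proof.
split=> [transverse k|tauH omega]; last exact: (crossing_only_at_delays hY hI).
have [yH YH yH1] := class_I_critical_value hI.
exact: (destabilizing_at_delay hY hI YH yH1 transverse).
Qed.
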